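(* Consider PPSGD run for $n$ rounds with personalization parameter $\alpha$, on the objective $f(w,\theta_{1:N})=\frac1N\sum_{i=1}^N f_i(w,\theta_i)$. Assume: (A1) $f$ admits a minimizer $z^*$ with finite norm $\|z^*\|_\alpha$; (A2) for all $i$ and $P_i$-almost every $\xi$, the function $(w,\theta_i)\mapsto f_i(w,\theta_i,\xi)$ is jointly convex and $L$-smooth (its gradient is $L$-Lipschitz); (A3) for all $i,w,\theta_i$ and $P_i$-almost every $\xi$, $\|\nabla_w f_i(w,\theta_i,\xi)\|\le G$. Let $z^*=(w^*,\theta^*_{1:N})$ be any minimizer of $f$ (with $\|z^*\|_\alpha<\infty$), let $L_\alpha:=L\max(\alpha,\frac1N)$ and $$\sigma_{tot,\alpha}^2:=\frac{\alpha\bar\sigma_w^2+\bar\sigma_\theta^2}{N}+\alpha d_w\sigma_\zeta^2 .$$ With step size $\eta=\min\Bigl\{\frac{1}{4L_\alpha},\frac{\|z^*\|_\alpha}{\sqrt n\,\sigma_{tot,\alpha}}\Bigr\}$ and clipping parameter $C=G$, PPSGD satisfies $$\mathbb{E}[f(\bar z_n)-f(z^* )]\le\frac{4L_\alpha\|z^*\|_\alpha^2}{n}+3\,\frac{\sigma_{tot,\alpha}\|z^*\|_\alpha}{\sqrt n},\qquad \bar z_n=\frac1n\sum_{t=0}^{n-1}z_t .$$ In particular, if $\sigma_\zeta=c\,\frac{G\sqrt{n\log(1/\delta)}}{N\epsilon}$ with $c>0$ an absolute constant, then, up to an absolute multiplicative constant (depending only on $c$) on the right-hand side, $$\mathbb{E}[f(\bar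 z_n)-f(z^* )]\lesssim\frac{L_\alpha\|z^*\|_\alpha^2}{n}+\|z^*\|_\alpha\sqrt{\frac{\alpha\bar\sigma_w^2+\bar\sigma_\theta^2}{Nn}}+\|z^*\|_\alpha\sqrt{\frac{\alpha d_w G^2\log(1/\delta)}{N^2\epsilon^2}} .$$
   Context: Setting: $N$ users; user $i$ has a sample distribution $P_i$ and loss $f_i(w,\theta_i,\xi)$, with global parameter $w\in\mathbb{R}^{d_w}$ and local parameter $\theta_i\in\mathbb{R}^{d_\theta}$. The expected risk is $f_i(w,\theta_i):=\mathbb{E}_{\xi\sim P_i}[f_i(w,\theta_i,\xi)]$. Write $\theta_{1:N}=(\theta_1,\dots,\theta_N)$ and $z=(w,\theta_{1:N})$. Norm: for $\alpha\geq 0$, $\|z\|_\alpha^2:=\frac1\alpha\|w\|^2+\|\theta_{1:N}\|^2$, where $\|\theta_{1:N}\|^2=\sum_i\|\theta_i\|^2$; for $\alpha=0$ the first term is $0$ if $w=0$ and $+\infty$ otherwise. Algorithm PPSGD. Inputs: $\eta$, $\alpha$, $\sigma_\zeta$, $C$, $n$. Initialize $w_0=0$, $\theta_{i,0}=0$. For $t=1,\dots,n$: every user $i$ draws a fresh sample $\xi_{i,t}\sim P_i$ (all samples independent), computes $g_{\theta,i}^t=\nabla_\theta f_i(w_{t-1},\theta_{i,t-1},\xi_{i,t})$ and $g_{w,i}^t=\nabla_w f_i(w_{t-1},\theta_{i,t-1},\xi_{i,t})$, updates $\theta_{i,t}=\theta_{i,t-1}-\frac\eta N g_{\theta,i}^t$,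 and sends $\tilde g_{w,i}^t=g_{w,i}^t/\max(1,\|g_{w,i}^t\|/C)$ to the server; the server draws $\zeta_t\sim\mathcal N(0,\sigma_\zeta^2I_{d_w})$ independently and updates $w_t=w_{t-1}-\alpha\eta\bigl(\frac1N\sum_{i=1}^N\tilde g_{w,i}^t+\zeta_t\bigr)$. Write $z_t=(w_t,\theta_{1,t},\dots,\theta_{N,t})$. Gradient variances at the minimizer $z^*=(w^*,\theta^*_{1:N})$, assumed finite: $\sigma_{w,i}^2=\mathbb{E}_{\xi\sim P_i}\|\nabla_wf_i(w^*,\theta_i^*,\xi)-\nabla_wf_i(w^*,\theta_i^* )\|^2$, $\sigma_{\theta,i}^2=\mathbb{E}_{\xi\sim P_i}\|\nabla_\theta f_i(w^*,\theta_i^*,\xi)\|^2$, $\bar\sigma_w^2=\frac1N\sum_i\sigma_{w,i}^2$, $\bar\sigma_\theta^2=\frac1N\sum_i\sigma_{\theta,i}^2$. If $\sigma_{tot,\alpha}=0$, the second term in the minimum defining $\eta$ is read as $+\infty$. Here $\epsilon>0$ and $\delta\in(0,1)$ are privacy parameters. *)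

(* Defs.v *)
From HB Require Import structures.
From mathcomp Require Import all_boot all_order all_algebra.
From mathcomp Require Import all_classical all_reals all_analysis.

Set Implicit Arguments.
Unset Strict Implicit.
Unset Printing Implicit Defensive.

Import Order.TTheory GRing.Theory Num.Theory.
Import numFieldNormedType.Exports.

Local Open Scope classical_set_scope.
Local Open Scope ring_scope.

Section Euclidean.
Context {R : realType}.

(* Euclidean norm of a vector, Frobenius norm of a matrix; the library norm on
   matrices is the sup norm. *)
Definition l2norm (m n : nat) (A : 'M[R]_(m, n)) : R :=
  Num.sqrt (\sum_(i < m) \sum_(j < n) A i j ^+ 2).

Definition gradient (d : nat) (F : 'rV[R]_d -> R) (x : 'rV[R]_d) : 'rV[R]_d :=
  \row_j 'D_(delta_mx 0 j) F x.

Variables (dw dth : nat).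

Definition grad_w (F : 'rV[R]_dw -> 'rV[R]_dth -> R) w th : 'rV[R]_dw :=
  gradient (F ^~ th) w.

Definition grad_th (F : 'rV[R]_dw -> 'rV[R]_dth -> R) w th : 'rV[R]_dth :=
  gradient (F w) th.

Definition jointly_convex (F : 'rV[R]_dw -> 'rV[R]_dth -> R) : Prop :=
  convex_function [set: convex_lmodType ('rV[R]_dw * 'rV[R]_dth)%type]
    (fun z => F z.1 z.2).

(* The library norm on pairs is a sup norm, which changes neither
   differentiability nor partial derivatives; the Lipschitz bound is written
   with the Euclidean norm of the pair. *)
Definition smooth (L : R) (F : 'rV[R]_dw -> 'rV[R]_dth -> R) : Prop :=
  (forall z : 'rV[R]_dw * 'rV[R]_dth,
     differentiable (fun y : 'rV[R]_dw * 'rV[R]_dth => F y.1 y.2) z) /\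
  (forall w w' th th',
     Num.sqrt (l2norm (grad_w F w th - grad_w F w' th') ^+ 2
               + l2norm (grad_th F w th - grad_th F w' th') ^+ 2)
     <= L * Num.sqrt (l2norm (w - w') ^+ 2 + l2norm (th - th') ^+ 2)).

End Euclidean.

Section Independence.
Context {R : realType} {d} {Om : measurableType d} (P : probability Om R).

Definition sigma_of {d'} {T : measurableType d'} (X : Om -> T) :
    set_system Om :=
  preimage_set_system [set: Om] X measurable.

Definition mutually_independent (I : finType) (F : I -> set_system Om) : Prop :=
  forall (J : {set I}) (A : I -> set Om),
    (forall k, k \in J -> F k (A k)) ->
    P (\bigcap_(k in [set` J]) A k) = (\prod_(k in J) P (A k))%E.

Definition has_law {d'} {T : measurableType d'} (X : {RV P >-> T})
    (mu : set T -> \bar R) : Prop :=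
  forall A, measurable A -> distribution P X A = mu A.

(* [normal_prob 0 0] is by convention not the point mass at 0. *)
Definition centered_normal (s : R) : set (measurableTypeR R) -> \bar R :=
  if s == 0 then \d_(0 : measurableTypeR R) else normal_prob 0 s.

(* X ~ N(0, s^2 I_k) *)
Definition isotropic_gaussian (k : nat) (s : R) (X : {RV P >-> k.-tuple R}) :
    Prop :=
  mutually_independent (fun j : 'I_k => sigma_of (fun om => tnth (X om) j)) /\
  (forall j : 'I_k, forall A : set (measurableTypeR R), measurable A ->
     P ((fun om => tnth (X om) j) @^-1` A) = centered_normal s A).

Definition source_sigma {d'} {T : measurableType d'} (N n k : nat)
    (xi : 'I_N -> nat -> {RV P >-> T}) (zeta : nat -> {RV P >-> k.-tuple R})
    (src : 'I_N * 'I_n + 'I_n) : set_system Om :=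
  match src with
  | inl it => sigma_of (xi it.1 it.2.+1)
  | inr t => sigma_of (zeta t.+1)
  end.

End Independence.

(* A point z = (w, theta_{1:N}): row i of the matrix is theta_i. *)
Notation params R dw N dth := ('rV[R]_dw * 'M[R]_(N, dth))%type (only parsing).

Section PPSGD.
Context {R : realType} {dX} {X : measurableType dX} {N dw dth : nat}.
Implicit Types (z : params R dw N dth) (alpha : R).

Definition normsq_alpha alpha z : \bar R :=
  if alpha == 0 then
    if z.1 == 0 then (l2norm z.2 ^+ 2)%:E else +oo%E
  else (alpha^-1 * l2norm z.1 ^+ 2 + l2norm z.2 ^+ 2)%:E.

Definition norm_alpha alpha z : \bar R := sqrte (normsq_alpha alpha z).

Variables (Pi : 'I_N -> probability X R).
Variable f : 'I_N -> 'rV[R]_dw -> 'rV[R]_dth -> X -> R.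

Definition user_risk (i : 'I_N) w th : R := fine ('E_(Pi i)[f i w th]).

Definition risk z : R :=
  N%:R^-1 * \sum_(i < N) user_risk i z.1 (row i z.2).

Definition is_minimizer z : Prop := forall z', risk z <= risk z'.

Definition sample_grad_w i w th x := grad_w (fun w' th' => f i w' th' x) w th.
Definition sample_grad_th i w th x := grad_th (fun w' th' => f i w' th' x) w th.

Definition var_w z (i : 'I_N) : \bar R :=
  'E_(Pi i)[fun x => l2norm (sample_grad_w i z.1 (row i z.2) x
                             - grad_w (user_risk i) z.1 (row i z.2)) ^+ 2].

Definition var_th z (i : 'I_N) : \bar R :=
  'E_(Pi i)[fun x => l2norm (sample_grad_th i z.1 (row i z.2) x) ^+ 2].

Definition avg_var_w z : R := N%:R^-1 * \sum_(i < N) fine (var_w z i).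
Definition avg_var_th z : R := N%:R^-1 * \sum_(i < N) fine (var_th z i).

Definition sigma_tot alpha sigma_zeta z : R :=
  Num.sqrt ((alpha * avg_var_w z + avg_var_th z) / N%:R
            + alpha * dw%:R * sigma_zeta ^+ 2).

Definition L_alpha L alpha : R := L * Num.max alpha N%:R^-1.

(* When s = 0 the quotient stands for +oo in the minimum. *)
Definition step_size (n : nat) L alpha sigma_zeta z : R :=
  let s := sigma_tot alpha sigma_zeta z in
  let eta1 := 1 / (4%:R * L_alpha L alpha) in
  if s == 0 then eta1
  else Num.min eta1 (fine (norm_alpha alpha z) / (Num.sqrt n%:R * s)).

Definition clip (C : R) (k : nat) (g : 'rV[R]_k) : 'rV[R]_k :=
  (Num.max 1 (l2norm g / C))^-1 *: g.

(* [x i t] and [v t] are the sample of user i and the server noise of round t,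
   for rounds t >= 1. *)
Fixpoint ppsgd (eta alpha C : R) (x : 'I_N -> nat -> X)
    (v : nat -> 'rV[R]_dw) (t : nat) : params R dw N dth :=
  if t is t'.+1 then
    let z := ppsgd eta alpha C x v t' in
    (z.1 - (alpha * eta) *:
       ((N%:R^-1 *: \sum_(i < N)
          clip C (sample_grad_w i z.1 (row i z.2) (x i t))) + v t),
     \matrix_(i < N)
       (row i z.2 - (eta / N%:R) *: sample_grad_th i z.1 (row i z.2) (x i t)))
  else (0, 0).

Definition ppsgd_avg (eta alpha C : R) (x : 'I_N -> nat -> X)
    (v : nat -> 'rV[R]_dw) (n : nat) : params R dw N dth :=
  n%:R^-1 *: \sum_(0 <= t < n) ppsgd eta alpha C x v t.

End PPSGD.

Definition row_of_tuple {R : realType} (k : nat) (u : k.-tuple R) : 'rV[R]_k :=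
  \row_j tnth u j.

(* Main.v *)
(* The proof follows the squared distance |z_t - zs|_alpha^2. Each sample loss is
   convex and L-smooth, so its gradients g at z_t and h at zs satisfy
   <g, z_t - zs> >= f(z_t) - f(zs) + |g - h|^2 / (4L). For eta <= 1/(4 L_alpha)
   the last term absorbs the part |g - h|^2 of the second order term of the step,
   and only the noise at zs remains. In expectation the fresh samples turn sample
   losses into risks, and the server noise drops out of the cross term; the
   w-gradients at zs average to 0 by optimality, so only their variance is left.
   Summation over t and Jensen's inequality give the bound
   |zs|_alpha^2 / (2 eta n) + eta sigma_tot^2.
   Convexity, smoothness and the gradient bound only hold almost surely: the
   losses are replaced by 0 on null sets of bad samples, after which they hold
   everywhere and nothing is clipped, and the new iterates agree with those of
   the algorithm outside of an event of probability 0. *)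
Require Import Defs.
From HB Require Import structures.
From mathcomp Require Import all_boot all_order all_algebra.
From mathcomp Require Import all_classical all_reals all_analysis.
From mathcomp Require Import measurable_realfun ring lra.

Set Implicit Arguments.
Unset Strict Implicit.
Unset Printing Implicit Defensive.

Import Order.TTheory GRing.Theory Num.Theory.
Import numFieldNormedType.Exports.

Local Open Scope classical_set_scope.
Local Open Scope ring_scope.

(** * Euclidean geometry and smooth convex functions *)

Section Dot.
Context {R : realType}.

(** Passing from sample losses to risks is a conditional expectation given everything but one
    source. It is realised by Fubini for two independent variables: the family of all other sources,
    as a sigma-algebra on [Om], and the single source that is averaged out. The iterate must then be
    measurable for that smaller sigma-algebra, and a sample loss evaluated at an iterate must be
    jointly measurable. The losses are only measurable for fixed parameters, so continuity in the
    parameter has to supply this. The original losses are controlled only outside null sets, so the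
    original averaged iterate may fail to be measurable. Its expectation is therefore bounded by
    monotonicity of the integral of nonnegative functions, which holds without measurability. The
    inequality |g|^2 <= 2|g - h|^2 + 2|h|^2 doubles the noise at [zs]. The final constants leave
    room for this: the doubled noise contributes [eta * sigma_tot^2], which uses only one unit of
    the constant 3. *)

Definition dot (d : nat) (u v : 'rV[R]_d) : R := \sum_j u 0 j * v 0 j.

Lemma dotC d (u v : 'rV[R]_d) : dot u v = dot v u.
Proof. by apply: eq_bigr => j _; rewrite mulrC. Qed.

Lemma dotDl d (u v w : 'rV[R]_d) : dot (u + v) w = dot u w + dot v w.
Proof. by rewrite -big_split/=; apply: eq_bigr => j _; rewrite !mxE mulrDl. Qed.

Lemma dotDr d (u v w : 'rV[R]_d) : dot w (u + v) = dot w u + dot w v.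
Proof. by rewrite dotC dotDl !(dotC w). Qed.

Lemma dotZl d a (u v : 'rV[R]_d) : dot (a *: u) v = a * dot u v.
Proof. by rewrite mulr_sumr; apply: eq_bigr => j _; rewrite !mxE mulrA. Qed.

Lemma dotZr d a (u v : 'rV[R]_d) : dot v (a *: u) = a * dot v u.
Proof. by rewrite dotC dotZl dotC. Qed.

Lemma dotNl d (u v : 'rV[R]_d) : dot (- u) v = - dot u v.
Proof. by rewrite -scaleN1r dotZl mulN1r. Qed.

Lemma dotNr d (u v : 'rV[R]_d) : dot v (- u) = - dot v u.
Proof. by rewrite dotC dotNl dotC. Qed.

Lemma dot0l d (u : 'rV[R]_d) : dot 0 u = 0.
Proof. by apply: big1 => j _; rewrite mxE mul0r. Qed.

Lemma dot0r d (u : 'rV[R]_d) : dot u 0 = 0.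
Proof. by rewrite dotC dot0l. Qed.

Lemma dot_suml d (I : Type) (r : seq I) (P : pred I) (F : I -> 'rV[R]_d) v :
  dot (\sum_(i <- r | P i) F i) v = \sum_(i <- r | P i) dot (F i) v.
Proof.
elim/big_rec2 : _ => [|i x y _ <-]; first exact: dot0l.
by rewrite dotDl.
Qed.

Lemma dot_ge0 d (u : 'rV[R]_d) : 0 <= dot u u.
Proof. by apply: sumr_ge0 => j _; rewrite -expr2 sqr_ge0. Qed.

Lemma dot_eq0 d (u : 'rV[R]_d) : dot u u = 0 -> u = 0.
Proof.
move=> /eqP; rewrite psumr_eq0 => [/allP u0|j _]; last by rewrite -expr2 sqr_ge0.
apply/rowP => j; rewrite mxE; apply/eqP.
by have := u0 j (mem_index_enum _); rewrite mulf_eq0 orbb.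
Qed.

Definition dotE := (dotDl, dotDr, dotNl, dotNr, dotZl, dotZr, dot0l, dot0r).

Lemma dot_young d (c : R) (u v : 'rV[R]_d) : 0 < c ->
  2%:R * dot u v <= c^-1 * dot u u + c * dot v v.
Proof.
move=> c0; have := dot_ge0 (u - c *: v).
rewrite !dotE (dotC v u) => H.
rewrite -(ler_pM2l c0) mulrDr mulVKf ?gt_eqF//; lra.
Qed.

(** The right side minus the left side is exactly |u - 2v|^2. Later [u] is a gradient at an iterate
    and [v] the gradient at [zs] for the same sample. *)
Lemma dotB_le d (u v : 'rV[R]_d) :
  dot u u <= 2%:R * dot (u - v) (u - v) + 2%:R * dot v v.
Proof.
have := dot_ge0 (u - 2%:R *: v).
rewrite !dotE (dotC v u); lra.
Qed.

Lemma dot_row_mx m n (a c : 'rV[R]_m) (b d : 'rV[R]_n) :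
  dot (row_mx a b) (row_mx c d) = dot a c + dot b d.
Proof.
rewrite /dot big_split_ord/=; congr (_ + _); apply: eq_bigr => j _.
  by rewrite !row_mxEl.
by rewrite !row_mxEr.
Qed.

Lemma dot_submx m n (u v : 'rV[R]_(m + n)) :
  dot u v = dot (lsubmx u) (lsubmx v) + dot (rsubmx u) (rsubmx v).
Proof. by rewrite -{1}(hsubmxK u) -{1}(hsubmxK v) dot_row_mx. Qed.

(** Variance identity: with m the average, the sum of |u_i - m|^2 equals the sum of |u_i|^2 minus N
    |m|^2. *)
Lemma dot_avg_le N d (u : 'I_N -> 'rV[R]_d) : (0 < N)%N ->
  dot (N%:R^-1 *: \sum_i u i) (N%:R^-1 *: \sum_i u i)
    <= N%:R^-1 * \sum_i dot (u i) (u i).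
Proof.
move=> N0; set m := _ *: _.
have N0' : (N%:R : R) != 0 by rewrite pnatr_eq0 -lt0n.
have mE : \sum_i u i = N%:R *: m by rewrite scalerA divff// scale1r.
clearbody m.
have H : 0 <= \sum_i dot (u i - m) (u i - m).
  by apply: sumr_ge0 => i _; exact: dot_ge0.
have E : \sum_i dot (u i - m) (u i - m) =
    \sum_i dot (u i) (u i) - N%:R * dot m m.
  transitivity (\sum_i (dot (u i) (u i) - 2%:R * dot (u i) m + dot m m)).
    by apply: eq_bigr => i _; rewrite !dotE (dotC m); ring.
  rewrite !big_split/= sumr_const card_ord sumrN -mulr_sumr -dot_suml.
  by rewrite mE dotZl -mulr_natl; ring.
rewrite E subr_ge0 in H.
by rewrite -(ler_pM2l (_ : 0 < N%:R)) ?ltr0n// mulVKf.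
Qed.

Lemma l2norm_ge0 m n (A : 'M[R]_(m, n)) : 0 <= l2norm A.
Proof. exact: sqrtr_ge0. Qed.

Lemma l2norm_sqr m n (A : 'M[R]_(m, n)) :
  l2norm A ^+ 2 = \sum_i dot (row i A) (row i A).
Proof.
rewrite sqr_sqrtr; last first.
  by apply: sumr_ge0 => i _; apply: sumr_ge0 => j _; exact: sqr_ge0.
by apply: eq_bigr => i _; apply: eq_bigr => j _; rewrite !mxE expr2.
Qed.

Lemma l2norm_dot d (u : 'rV[R]_d) : l2norm u ^+ 2 = dot u u.
Proof. by rewrite l2norm_sqr big_ord1 row_id. Qed.

Lemma l2norm_le d (u : 'rV[R]_d) (c : R) : 0 <= c ->
  (l2norm u <= c) = (dot u u <= c ^+ 2).
Proof. by move=> c0; rewrite -l2norm_dot ler_pXn2r// nnegrE l2norm_ge0. Qed.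

Lemma dot_coord_le d (u : 'rV[R]_d) j : u 0 j ^+ 2 <= dot u u.
Proof.
rewrite /dot (bigD1 j)//= -expr2 lerDl.
by apply: sumr_ge0 => i _; rewrite -expr2 sqr_ge0.
Qed.

Lemma dot_norm_le d (u v : 'rV[R]_d) : `|dot u v| <= dot u u + dot v v.
Proof.
have := dot_ge0 (u - v); have := dot_ge0 (u + v).
have := dot_ge0 u; have := dot_ge0 v.
rewrite !dotE (dotC v u) ler_norml => *; apply/andP; split; lra.
Qed.

End Dot.

Section SmoothConvex.
Context {R : realType} {d : nat}.
Variables (F : 'rV[R]_d -> R) (g : 'rV[R]_d -> 'rV[R]_d) (L : R).

(** Convexity and smoothness are carried by this inequality and a Lipschitz bound on [g]. Neither
    mentions derivatives, and the zero function with zero gradient satisfies both, which makes the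
    replacement of losses by 0 possible. *)
Definition subgradient : Prop := forall x y, F x + dot (g x) (y - x) <= F y.

Definition lipschitz_l2 : Prop := forall x y,
  dot (g x - g y) (g x - g y) <= L ^+ 2 * dot (x - y) (x - y).

Hypotheses (L_gt0 : 0 < L) (Fg : subgradient) (gL : lipschitz_l2).

Lemma dot_grad_diff_le x y : dot (g y - g x) (y - x) <= L * dot (y - x) (y - x).
Proof.
have := dot_young (g y - g x) (y - x) L_gt0; have := gL y x.
set a := dot _ _; set b := dot _ _; set e := dot _ _ => H1 H2.
have : L^-1 * a <= L * b by rewrite -(ler_pM2l L_gt0) mulVKf ?gt_eqF//; lra.
lra.
Qed.

(** The subgradient inequality at [y] bounds F y - F x by <g y, y - x>, and [g y] is then exchanged
    for [g x]. This avoids integration along the segment and gives L in place of L/2. *)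
Lemma subgradient_upper x y :
  F y <= F x + dot (g x) (y - x) + L * dot (y - x) (y - x).
Proof.
have := Fg y x; have := dot_grad_diff_le x y.
rewrite !dotE; lra.
Qed.

(* A gradient step of length 1/(2L) from [y] on [F - <g x, .>], which is
   minimal at [x]. The constant is half of the sharp one, which would need the
   descent lemma with its factor L/2. *)
Lemma cocoercive x y :
  F x + dot (g x) (y - x) + (4%:R * L)^-1 * dot (g y - g x) (g y - g x) <= F y.
Proof.
set s := (2%:R * L)^-1; set D := g y - g x.
have gyE : g y = D + g x by rewrite subrK.
clearbody D.
have sL : s * L = 2%:R^-1 by rewrite /s; field; rewrite gt_eqF.
have s0 : 0 < s by rewrite invr_gt0 mulr_gt0.
have -> : (4%:R * L)^-1 = s / 2%:R by rewrite /s; field; rewrite gt_eqF.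
pose u := y - s *: D.
have H1 := Fg x u; have H2 := Fg u y.
have uy : y - u = s *: D by rewrite /u opprB addrC subrK.
have yu : u - y = - (s *: D) by rewrite -uy opprB.
have ux : u - x = (y - x) - s *: D by rewrite /u addrAC.
have H3 := gL u y; rewrite yu !(dotNl, dotNr, dotZl, dotZr) in H3.
(* A step of length 1/(2L) changes the gradient by at most |D|/2 in norm, so Young with weight 1/2
   gives <g u - g y, D> >= -|D|^2/2: half of the decrease s |D|^2 survives. *)
have H4 := @dot_young R _ 2%:R^-1 (- (g u - g y)) D.
rewrite uy in H2; rewrite ux in H1.
have h2 : (0 : R) < 2%:R^-1 by rewrite invr_gt0.
have {}H4 := H4 h2.
rewrite invrK in H4.
have E3 : L ^+ 2 * - - (s * (s * dot D D)) = 2%:R^-1 ^+ 2 * dot D D.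
  by rewrite -sL; ring.
rewrite E3 in H3.
have H5 : - 2%:R^-1 * dot D D <= dot (g u - g y) D.
  move: H3 H4; rewrite !dotE; lra.
have E6 : g u = (g u - g y) + D + g x.
  by rewrite -addrA -gyE subrK.
have H7 : s * dot (g u) D = s * dot (g u - g y) D + s * dot D D + s * dot (g x) D.
  by rewrite {1}E6 !dotDl !mulrDr.
have H8 : s * (- 2%:R^-1 * dot D D) <= s * dot (g u - g y) D.
  by rewrite ler_pM2l.
move: H1 H2; rewrite dotDr dotNr !dotZr H7; lra.
Qed.

End SmoothConvex.

(** * Measurability and independence *)

Section LowerIntegral.
Context {d} {T : measurableType d} {R : realType}.
Variable mu : {measure set T -> \bar R}.
Local Open Scope ereal_scope.
Import HBNNSimple.

(* No measurability of [f] or [g] is assumed: the integral of a nonnegative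
   function is a supremum over the simple functions below it, and such a
   function can be cut off on the null set [~` E]. *)
Lemma ge0_le_integral_nonmeasurable (E : set T) (f g : T -> \bar R) :
  measurable E -> mu (~` E) = 0 -> (forall x, 0 <= f x) ->
  (forall x, 0 <= g x) -> (forall x, E x -> f x <= g x) ->
  \int[mu]_x f x <= \int[mu]_x g x.
Proof.
move=> mE E0 f0 g0 fg; rewrite !ge0_integralTE//.
apply: ge_ereal_sup => _ [h /= hf <-].
have prE x : proj_nnsfun h mE x = (h \_ E) x by rewrite mrestrict.
apply: ereal_sup_ubound; exists (proj_nnsfun h mE) => /=.
  move=> x; apply: (@le_trans _ _ ((h \_ E) x)%:E); first by rewrite -prE.
  rewrite patchE; case: ifPn => [xE|_]; last exact: g0.
  by rewrite (le_trans (hf x))// fg// -in_setE.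
rewrite -[LHS]/(sintegral mu (proj_nnsfun h mE)).
transitivity (\int[mu]_x (proj_nnsfun h mE x)%:E).
  by rewrite integral_nnsfun// patch_setT.
transitivity (\int[mu]_x (h x)%:E); last by rewrite integral_nnsfun// patch_setT.
apply: ge0_ae_eq_integral => //.
- exact/measurable_EFinP.
- exact/measurable_EFinP.
- by move=> x _; rewrite lee_fin.
- by move=> x _; rewrite lee_fin.
exists (~` E); split => //; first exact: measurableC.
move=> x /= H Ex; apply: H => _.
by rewrite -[LHS]/((proj_nnsfun h mE x)%:E) prE patchE mem_set.
Qed.

End LowerIntegral.

Section Grid.
Context {R : realType} {k : nat}.

(** A countable family of points whose rounding converges coordinatewise to any vector. It serves to
    prove joint measurability, and to move an almost-everywhere statement through uncountably many
    parameters. *)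
Definition grid_point (n : nat) (q : 'rV[int]_k) : 'rV[R]_k :=
  \row_j (n.+1%:R^-1 * (q 0 j)%:~R).

Definition grid_floor (n : nat) (v : 'rV[R]_k) : 'rV[int]_k :=
  \row_j Num.floor (n.+1%:R * v 0 j).

Lemma grid_cvg (v : 'rV[R]_k) j :
  grid_point n (grid_floor n v) 0 j @[n --> \oo] --> v 0 j.
Proof.
have H n : `|v 0 j - grid_point n (grid_floor n v) 0 j| <= n.+1%:R^-1.
  rewrite !mxE; have n0 : (0 : R) < n.+1%:R by rewrite ltr0n.
  rewrite -(ler_pM2l n0) mulfV ?gt_eqF// -{1}(gtr0_norm n0) -normrM.
  rewrite mulrBr mulVKf ?gt_eqF//.
  set y := _ * v 0 j.
  rewrite ger0_norm ?subr_ge0 ?floor_le_tmp// lerBlDl.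
  by rewrite -intrD1 ltW// floorD1_gt.
apply/cvgrPdist_le => e e0; near=> n.
apply: (le_trans (H n)).
near: n; have := @cvg_harmonic R => /cvgrPdist_le/(_ _ e0).
apply: filterS => n; rewrite sub0r normrN ger0_norm// invr_ge0//.
Unshelve. all: by end_near. Qed.

End Grid.

Section Caratheodory.
Context {R : realType} {dT dX : measure_display} {T : measurableType dT}
  {X : measurableType dX} {k : nat}.

Lemma measurable_grid_floor (u : T -> 'rV[R]_k) n (q : 'rV[int]_k) :
  (forall j, measurable_fun setT (fun t => u t 0 j)) ->
  measurable [set t | grid_floor n (u t) = q].
Proof.
move=> mu; rewrite (_ : [set _ | _] = \bigcap_(j in [set: 'I_k])
    (fun t => n.+1%:R * u t 0 j) @^-1` `[(q 0 j)%:~R, (q 0 j + 1)%:~R[).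
  apply: fin_bigcap_measurable => // j _; rewrite -[X in measurable X]setTI.
  by apply: measurable_funM.
apply/seteqP; split => [t /= <- j _|t /= H].
  by rewrite /= in_itv/= mxE floor_le_tmp floorD1_gt.
apply/rowP => j; rewrite mxE.
by have := H j I; rewrite /= in_itv/= => ?; exact: floor_def.
Qed.

(** Once [u] is rounded to the grid, a preimage splits into countably many measurable pieces, one
    for each grid point. Continuity in the parameter makes the function a pointwise limit of these
    roundings. *)
Lemma caratheodory_measurable (phi : 'rV[R]_k -> X -> R) (u : T -> 'rV[R]_k)
    (xi : T -> X) :
  (forall v, measurable_fun setT (phi v)) ->
  (forall x (v_ : nat -> 'rV[R]_k) (v : 'rV[R]_k),
    (forall j, v_ n 0 j @[n --> \oo] --> v 0 j) ->
    phi (v_ n) x @[n --> \oo] --> phi v x) ->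
  (forall j, measurable_fun setT (fun t => u t 0 j)) ->
  measurable_fun setT xi ->
  measurable_fun setT (fun t => phi (u t) (xi t)).
Proof.
move=> mphi cphi mu mxi.
pose un n t := grid_point n (grid_floor n (u t)) : 'rV[R]_k.
apply: (@measurable_fun_cvg _ _ _ _ (fun n t => phi (un n t) (xi t))).
  move=> n _ A mA; rewrite setTI.
  rewrite (_ : _ @^-1` _ = \bigcup_(q : 'rV[int]_k)
      ([set t | grid_floor n (u t) = q] `&`
       (xi @^-1` (phi (grid_point n q) @^-1` A)))).
    apply: countable_bigcupT_measurable => // q.
    apply: measurableI; first exact: measurable_grid_floor.
    rewrite -[X in measurable X]setTI; apply: mxi => //.
    by rewrite -[X in measurable X]setTI; exact: mphi.
  apply/seteqP; split => [t /= H|t /= [q _ [/= <- H]]]//.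
  by exists (grid_floor n (u t)).
by move=> t _; apply: cphi => j; exact: grid_cvg.
Qed.

End Caratheodory.

Section Independence.
Context {R : realType} {d} {Om : measurableType d} (P : probability Om R).
Variables (I : finType) (F : I -> set_system Om).
Hypotheses (F_indep : mutually_independent P F)
  (F_meas : forall k, F k `<=` measurable)
  (FT : forall k, F k setT) (FI : forall k, setI_closed (F k)).

(** A pi-system generating the joint sigma-algebra of the sources in [J]. *)
Definition cylinder (J : {set I}) : set_system Om :=
  [set A | exists2 B : I -> set Om, (forall k, F k (B k)) &
     A = \bigcap_(k in [set` J]) B k].

Lemma cylinder_setI_closed J : setI_closed (cylinder J).
Proof.
move=> _ _ [B1 FB1 ->] [B2 FB2 ->]; exists (fun k => B1 k `&` B2 k).
  by move=> k; exact: FI.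
by rewrite bigcapI.
Qed.

Lemma cylinder_measurable J : cylinder J `<=` measurable.
Proof.
move=> _ [B FB ->]; apply: fin_bigcap_measurable => // k _.
exact/F_meas/FB.
Qed.

Lemma sigma_cylinder_measurable J : <<s cylinder J >> `<=` measurable.
Proof.
apply: smallest_sub; first exact: sigma_algebra_measurable.
exact: cylinder_measurable.
Qed.

Lemma cylinder_single (J : {set I}) k A : k \in J -> F k A -> cylinder J A.
Proof.
move=> kJ FA; exists (fun i => if i == k then A else setT).
  by move=> i; case: eqP => [->|].
apply/seteqP; split => [x Ax i _|x /(_ k)]; first by case: eqP.
by rewrite eqxx; exact.
Qed.

Lemma cylinder_indep (J : {set I}) k A C : k \notin J -> cylinder J A ->
  F k C -> P (A `&` C) = (P A * P C)%E.
Proof.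
move=> kJ [B FB ->] FC.
pose B' i := if i == k then C else B i.
have B'k : B' k = C by rewrite /B' eqxx.
have FB' i : F i (B' i) by rewrite /B'; case: eqP => [->|].
have BB' : {in J, B =1 B'}.
  by move=> i iJ; rewrite /B' ifN//; apply: contraNneq kJ => <-.
have -> : \bigcap_(i in [set` J]) B i = \bigcap_(i in [set` J]) B' i.
  by apply: eq_bigcapr => i /=; exact: BB'.
have -> : \bigcap_(i in [set` J]) B' i `&` C =
    \bigcap_(i in [set` (k |: J)%SET]) B' i.
  rewrite -B'k.
  apply/seteqP; split => [x [Bx Cx] i /=|x Bx].
    by rewrite in_setU1 => /orP[/eqP->//|iJ]; exact: Bx.
  split => [i iJ|]; apply: Bx => /=; rewrite in_setU1 ?eqxx//.
  by rewrite iJ orbT.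
rewrite !F_indep//.
by rewrite big_setU1//= muleC B'k.
Qed.

(** Dynkin's argument: for fixed [C], the events independent of [C] form a lambda-system containing
    the cylinders. *)
Lemma sigma_cylinder_indep (J : {set I}) k A C : k \notin J ->
  <<s cylinder J >> A -> F k C -> P (A `&` C) = (P A * P C)%E.
Proof.
move=> kJ + FC; move: A.
have mC : measurable C by exact: F_meas FC.
pose H := [set A | measurable A /\ P (A `&` C) = (P A * P C)%E].
suff : <<s cylinder J >> `<=` H by move=> sub A /sub [].
apply: lambda_system_subset => //.
- exact: cylinder_setI_closed.
- split => //.
  + by split => //; rewrite setTI probability_setT mul1e.
  + move=> A B BA [mA HA] [mB HB]; split; first exact: measurableD.
    have -> : (A `\` B) `&` C = (A `&` C) `\` (B `&` C).
      apply/seteqP; split => x /=; first by move=> [[? ?] ?]; split => // -[].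
      by move=> [[? ?] H']; split => //; split => // ?; exact: H'.
    have PD U V : measurable U -> measurable V -> V `<=` U ->
        (P (U `\` V) = P U - P V)%E.
      move=> mU mV VU; rewrite -[in RHS](setIidr VU); apply: measureD => //.
      by rewrite ltey_eq fin_num_measure.
    rewrite !PD//; [|exact: measurableI..|exact: setSI].
    rewrite HA HB muleBl ?fin_num_measure//.
    by rewrite fin_num_adde_defl// fin_numN fin_num_measure.
  + move=> G ndG HG; have mG i : measurable (G i) by have [] := HG i.
    split; first exact: bigcup_measurable.
    rewrite setI_bigcupl.
    have c1 : P (G i `&` C) @[i --> \oo] --> P (\bigcup_i (G i `&` C)).
      apply: nondecreasing_cvg_mu.
      * by move=> i; exact: measurableI.
      * by apply: bigcup_measurable => i _; exact: measurableI.
      * by move=> i j ij; apply/subsetPset; apply: setSI; apply/subsetPset/ndG.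
    have c2 : (P (G i) * P C)%E @[i --> \oo] --> (P (\bigcup_i G i) * P C)%E.
      apply: cvgeZr; first by rewrite fin_num_measure.
      by apply: nondecreasing_cvg_mu => //; exact: bigcup_measurable.
    have E : (fun i => P (G i) * P C)%E = (fun i => P (G i `&` C)).
      by apply/funext => i; exact/esym/(HG i).2.
    by move: c2; rewrite E => c2; exact: (cvg_unique _ c1 c2).
- move=> A cA; split; first exact: cylinder_measurable cA.
  exact: cylinder_indep kJ cA FC.
Qed.

End Independence.

Section IndependentFubini.
Context {R : realType} {d d1 d2} {Om : measurableType d}
  {T1 : measurableType d1} {T2 : measurableType d2} (P : probability Om R).
Variables (X1 : {RV P >-> T1}) (X2 : {RV P >-> T2}).
Hypothesis X12_indep : forall A B, measurable A -> measurable B ->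
  P (X1 @^-1` A `&` X2 @^-1` B) = (P (X1 @^-1` A) * P (X2 @^-1` B))%E.

Let X12 om := (X1 om, X2 om).

Let mX12 : measurable_fun setT X12.
Proof. exact: measurable_fun_pair. Qed.

HB.instance Definition _ := isMeasurableFun.Build _ _ _ _ X12 mX12.

Variable h : T1 * T2 -> R.
Hypotheses (mh : measurable_fun setT h)
  (ih : P.-integrable setT (fun om => (h (X1 om, X2 om))%:E))
  (ih2 : forall a, (distribution P X2).-integrable setT
     (fun b => (h (a, b))%:E)).

Let law_pair : forall A, measurable A ->
  (distribution P X1 \x distribution P X2)%E A = distribution P X12 A.
Proof.
apply: product_measure_unique => A B mA mB.
by rewrite /distribution /pushforward -X12_indep.
Qed.

Let ih_prod :
  (distribution P X1 \x distribution P X2)%E.-integrable setT (EFin \o h).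
Proof.
have /integrableP[m1 i1] : (distribution P X12).-integrable setT (EFin \o h).
  by apply: integrable_pushforward => //; exact/measurable_EFinP.
apply/integrableP; split => //.
rewrite (_ : integral _ _ _ =
  (\int[distribution P X12]_x `|(EFin \o h) x|)%E)//.
by apply: eq_measure_integral => A mA _; exact: law_pair.
Qed.

(** The conditional expectation of h (X1, X2) given X1 = a. Integrability in the second variable for
    every [a] makes it a real number everywhere. *)
Let inner a : R := \int[distribution P X2]_b h (a, b).

Let innerE a : (\int[distribution P X2]_b (h (a, b))%:E)%E = (inner a)%:E.
Proof. by rewrite /inner /Rintegral fineK// integrable_fin_num. Qed.

Lemma indep_inner_integrable :
  P.-integrable setT (fun om => (inner (X1 om))%:E).
Proof.
have /(eq_integrable measurableT) H := integrable_fubini_F ih_prod.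
have {}H : (distribution P X1).-integrable setT (EFin \o inner).
  by apply: H => a _; exact: innerE.
have /integrableP[mi ii] := H.
apply/integrableP; split; first exact: measurableT_comp mi _.
rewrite -(ge0_integral_distribution X1 (f := fun a => `|(EFin \o inner) a|%E))//.
exact: measurableT_comp.
Qed.

Lemma indep_integral : \int[P]_om h (X1 om, X2 om) = \int[P]_om inner (X1 om).
Proof.
congr fine.
rewrite -[LHS](integral_distribution (X := X12) (f := EFin \o h))//; last first.
  exact/measurable_EFinP.
transitivity (\int[(distribution P X1 \x distribution P X2)%E]_x (EFin \o h) x)%E.
  by apply: eq_measure_integral => A mA _; exact/esym/law_pair.
rewrite -integral12_prod_meas1//.
have mF := measurable_fubini_F ih_prod.
rewrite integral_distribution//; last first.
  apply: eq_integrable indep_inner_integrable => // om _.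
  exact/esym/innerE.
by apply: eq_integral => om _; exact: innerE.
Qed.

End IndependentFubini.

(** * Moments of the Gaussian *)

Lemma sq_integrable {R : realType} {d} {T : measurableType d}
    (P : probability T R) (g : T -> R) : measurable_fun setT g ->
  P.-integrable setT (fun x => (g x ^+ 2)%:E) ->
  P.-integrable setT (EFin \o g).
Proof.
move=> mg ig; apply: (@le_integrable _ _ _ _ _ measurableT _
    (EFin \o (fun x => g x ^+ 2 + 1))).
- exact/measurable_EFinP.
- move=> x _ /=; rewrite lee_fin.
  rewrite [leRHS]ger0_norm ?addr_ge0 ?sqr_ge0//.
  have := sqr_ge0 (g x - 1); have := sqr_ge0 (g x + 1).
  by rewrite ler_norml => *; apply/andP; split; nra.
- rewrite (_ : _ \o _ = ((fun x => (g x ^+ 2)%:E) \+ cst 1%:E)%E)//.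
  by apply: integrableD => //; exact: finite_measure_integrable_cst.
Qed.

Section GaussianMoments.
Context {R : realType}.
Local Notation mu := (@lebesgue_measure R).
Local Notation TR := (measurableTypeR R).
Import HBNNSimple.

(** The Radon-Nikodym derivative of the normal law and [normal_pdf] have the same integral over
    every measurable set, hence agree almost everywhere. *)
Lemma ge0_integral_normal_prob (m s : R) (g : TR -> \bar R) :
  measurable_fun setT g -> (forall x, 0 <= g x)%E ->
  (\int[normal_prob m s]_x g x = \int[mu]_x (g x * (normal_pdf m s x)%:E))%E.
Proof.
move=> mg g0.
have numu := normal_prob_dominates m s.
rewrite -(Radon_Nikodym_SigmaFinite.change_of_variables numu g0)//.
have mRN : measurable_fun setT
    (Radon_Nikodym_SigmaFinite.f (normal_prob m s) mu).
  exact: measurable_int (Radon_Nikodym_SigmaFinite.f_integrable numu).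
have mpdf : measurable_fun setT (fun x : TR => (normal_pdf m s x)%:E).
  by apply/measurable_EFinP; exact: measurable_normal_pdf.
apply: ge0_ae_eq_integral => //.
- exact: emeasurable_funM.
- exact: emeasurable_funM.
- by move=> x _; rewrite mule_ge0// Radon_Nikodym_SigmaFinite.f_ge0.
- by move=> x _; rewrite mule_ge0// lee_fin normal_pdf_ge0.
apply: ae_eqe_mul2l; apply: integral_ae_eq => //.
- exact: Radon_Nikodym_SigmaFinite.f_integrable.
- by move=> A _ mA; rewrite -Radon_Nikodym_SigmaFinite.f_integral.
Qed.

(* [x^2 <= 4 s^2 (exp (x^2 / (4 s^2)) - 1)], and the exponential turns the
   density of N(0, s^2) into [sqrt 2] times that of N(0, 2 s^2). The factor 2
   lost on the exact second moment fits in the slack of the final bound. *)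
Lemma normal_second_moment_le (s : R) : s != 0 ->
  (\int[normal_prob 0 s]_x ((x : R) ^+ 2)%:E <= (2%:R * s ^+ 2)%:E)%E.
Proof.
move=> s0; have s20 : 0 < s ^+ 2 by rewrite exprn_even_gt0.
have r20 : Num.sqrt 2%:R * s != 0 by rewrite mulf_neq0// gt_eqF ?sqrtr_gt0.
have peakE : normal_peak s = Num.sqrt 2%:R * normal_peak (Num.sqrt 2%:R * s).
  have -> : normal_peak (Num.sqrt 2%:R * s) =
      (Num.sqrt 2%:R * Num.sqrt (s ^+ 2 * pi *+ 2))^-1.
    rewrite -sqrtrM// /normal_peak exprMn sqr_sqrtr//.
    by congr (Num.sqrt _)^-1; ring.
  by rewrite invfM mulVKf// gt_eqF ?sqrtr_gt0.
have pdfE x : expR (x ^+ 2 / (4%:R * s ^+ 2)) * normal_pdf 0 s x =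
    Num.sqrt 2%:R * normal_pdf 0 (Num.sqrt 2%:R * s) x.
  rewrite !normal_pdfE// /normal_fun subr0 mulrCA -expRD peakE -mulrA.
  congr (_ * (_ * expR _)); rewrite exprMn sqr_sqrtr//.
  rewrite -(mulr_natl (s ^+ 2)) -(mulr_natl (2%:R * s ^+ 2)).
  by field; rewrite s0.
have bound x : x ^+ 2 * normal_pdf 0 s x <= 4%:R * s ^+ 2 *
    (Num.sqrt 2%:R * normal_pdf 0 (Num.sqrt 2%:R * s) x - normal_pdf 0 s x).
  rewrite -pdfE -[X in _ - X]mul1r -mulrBl mulrA.
  apply: ler_wpM2r; first exact: normal_pdf_ge0.
  have c0 : 0 < 4%:R * s ^+ 2 by rewrite mulr_gt0.
  rewrite -[leLHS](divfK (lt0r_neq0 c0)) mulrC ler_pM2l// lerBrDl.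
  exact: expR_ge1Dx.
rewrite ge0_integral_normal_prob//=; last 2 first.
- by apply/measurable_EFinP; exact: measurable_funX.
- by move=> x; rewrite lee_fin sqr_ge0.
have iN t := @integrable_normal_pdf R 0 t.
pose B (x : R) := 4%:R * s ^+ 2 *
  (Num.sqrt 2%:R * normal_pdf 0 (Num.sqrt 2%:R * s) x - normal_pdf 0 s x).
have BE : EFin \o B = (fun x : TR => (4%:R * s ^+ 2)%:E *
    ((fun x => (Num.sqrt 2%:R)%:E * (normal_pdf 0 (Num.sqrt 2%:R * s) x)%:E) \-
      (fun x => (normal_pdf 0 s x)%:E)) x)%E.
  by apply/funext => x.
have i1 : mu.-integrable setT (fun x : TR =>
    (Num.sqrt 2%:R)%:E * (normal_pdf 0 (Num.sqrt 2%:R * s) x)%:E)%E.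
  exact: integrableZl.
have iB : mu.-integrable setT (EFin \o B).
  by rewrite BE; apply: integrableZl => //; exact: integrableB.
apply: (@le_trans _ _ (\int[mu]_x (EFin \o B) x)%E).
  apply: ge0_le_integral => //.
  - by move=> x _; rewrite lee_fin mulr_ge0 ?sqr_ge0 ?normal_pdf_ge0.
  - apply/measurable_EFinP; apply: measurable_funM; first exact: measurable_funX.
    exact: measurable_normal_pdf.
  - exact: measurable_int iB.
  - by move=> x _; rewrite lee_fin.
rewrite BE integralZl//; last exact: integrableB.
rewrite integralB// integralZl// !integral_normal_pdf mule1 -EFinB -EFinM lee_fin.
(* The integral of the bound is 4 s^2 (sqrt 2 - 1), which this turns into at most 2 s^2. *)
have : Num.sqrt 2%:R <= 3%:R / 2%:R :> R.
  rewrite -(@ler_pXn2r _ 2) ?nnegrE ?sqrtr_ge0//.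
  by rewrite sqr_sqrtr//; lra.
move: s20; nra.
Qed.

Lemma ge0_integral_normal_probN (s : R) (g : TR -> \bar R) : s != 0 ->
  measurable_fun setT g -> (forall x, 0 <= g x)%E ->
  (\int[normal_prob 0 s]_x g (- (x : R))%R = \int[normal_prob 0 s]_x g x)%E.
Proof.
move=> s0 mg g0; have mN : measurable_fun setT (-%R : TR -> TR).
  exact: oppr_measurable.
have mpdf : measurable_fun setT (fun x : TR => (normal_pdf 0 s x)%:E).
  by apply/measurable_EFinP; exact: measurable_normal_pdf.
rewrite !ge0_integral_normal_prob//; last exact: measurableT_comp.
have pdfN (x : R) : normal_pdf 0 s (- x) = normal_pdf 0 s x.
  by rewrite !normal_pdfE// /normal_fun !subr0 sqrrN.
under eq_integral do rewrite -pdfN.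
pose k (x : TR) := (g x * (normal_pdf 0 s x)%:E)%E.
have mk : measurable_fun setT k by exact: emeasurable_funM.
have k0 x : (0 <= k x)%E by rewrite mule_ge0// lee_fin normal_pdf_ge0.
rewrite -[LHS](@ge0_integral_pushforward _ _ TR TR R -%R mN mu setT k)//.
by apply: eq_measure_integral => A mA _; exact: lebesgue_measureN.
Qed.

Lemma normal_sq_integrable (s : R) : s != 0 ->
  (normal_prob 0 s).-integrable setT (fun x : TR => ((x : R) ^+ 2)%:E).
Proof.
move=> s0; apply/integrableP; split.
  by apply/measurable_EFinP; exact: measurable_funX.
rewrite (le_lt_trans _ (ltry (2%:R * s ^+ 2)))//.
apply: le_trans (normal_second_moment_le s0).
by under eq_integral do rewrite /= ger0_norm ?sqr_ge0//.
Qed.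

(** Reflection exchanges the positive and negative parts of the identity, so their integrals agree;
    the second moment makes them finite and the difference meaningful. *)
Lemma normal_mean0 (s : R) : s != 0 -> \int[normal_prob 0 s]_x (x : R) = 0.
Proof.
move=> s0; pose e : TR -> \bar R := EFin.
have me : measurable_fun setT e by exact: EFin_measurable.
rewrite -[LHS]/(fine (\int[normal_prob 0 s]_x e x)) integralE.
have mp : measurable_fun setT (e^\+)%E by exact: measurable_funepos.
have -> : (\int[normal_prob 0 s]_x (e^\- x) =
    \int[normal_prob 0 s]_x (e^\+ x))%E.
  rewrite -(ge0_integral_normal_probN s0 mp)//; apply: eq_integral => x _.
  by rewrite funenegE funeposE.
have fin : (\int[normal_prob 0 s]_x (e^\+ x))%E \is a fin_num.
  apply: integrable_pos_fin_num => //.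
  by apply: sq_integrable => //; exact: normal_sq_integrable.
exact: (congr1 fine (subee fin)).
Qed.

Section Law.
Context {d} {Om : measurableType d} (P : probability Om R).
Variables (Y : {RV P >-> TR}) (s : R).
Hypothesis Y_law : forall A : set TR, measurable A ->
  P (Y @^-1` A) = centered_normal s A.

Lemma centered_normal_moments :
  [/\ P.-integrable setT (fun om => (Y om ^+ 2)%:E),
     \int[P]_om (Y om ^+ 2) <= 2%:R * s ^+ 2 & \int[P]_om Y om = 0].
Proof.
have msq : measurable_fun setT (fun x : TR => ((x : R) ^+ 2)%:E).
  by apply/measurable_EFinP; exact: measurable_funX.
have mid : measurable_fun setT (EFin : TR -> \bar R) by exact: EFin_measurable.
have mYsq : measurable_fun setT (fun om => (Y om ^+ 2)%:E).
  exact: (measurableT_comp msq).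
have EsqE : (\int[P]_om (Y om ^+ 2)%:E =
    \int[distribution P Y]_x ((x : R) ^+ 2)%:E)%E.
  by rewrite ge0_integral_distribution// => y; rewrite lee_fin sqr_ge0.
have bound : (\int[P]_om (Y om ^+ 2)%:E <= (2%:R * s ^+ 2)%:E)%E.
  rewrite EsqE; move: Y_law; rewrite /centered_normal.
  have [->|s0] := eqVneq s 0 => Ylaw.
    rewrite (eq_measure_integral (\d_(0 : TR))) => [|A mA _]; last exact: Ylaw.
    by rewrite integral_dirac// diracT mul1e lee_fin expr0n/= mulr0.
  rewrite (eq_measure_integral (normal_prob 0 s)) => [|A mA _]; last exact: Ylaw.
  exact: normal_second_moment_le.
have iYsq : P.-integrable setT (fun om => (Y om ^+ 2)%:E).
  apply/integrableP; split => //.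
  rewrite (le_lt_trans _ (ltry (2%:R * s ^+ 2)))//.
  apply: le_trans bound.
  by under eq_integral do rewrite /= ger0_norm ?sqr_ge0//.
split => //.
  by rewrite -lee_fin fineK// integrable_fin_num.
have iY : P.-integrable setT (EFin \o Y) by exact: (sq_integrable (measurable_funPT Y)).
rewrite /Rintegral -(integral_distribution (X := Y) (f := EFin))//.
move: Y_law; rewrite /centered_normal.
have [_|s0] := eqVneq s 0 => Ylaw.
  rewrite (eq_measure_integral (\d_(0 : TR))) => [|A mA _]; last exact: Ylaw.
  by rewrite integral_dirac// diracT mul1e.
rewrite (eq_measure_integral (normal_prob 0 s)) => [|A mA _]; last exact: Ylaw.
exact: normal_mean0.
Qed.

End Law.

End GaussianMoments.

(** * Derivatives and subgradients *)

Section Calculus.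
Context {R : realType}.

Lemma derivable_cvg_seq (V : normedModType R) (f : V -> R) a v :
  derivable f a v ->
  n.+1%:R * (f (n.+1%:R^-1 *: v + a) - f a) @[n --> \oo] --> 'D_v f a.
Proof.
move=> /cvgr_dnbhsP/(_ (@harmonic R)) H.
rewrite (_ : (fun n => _) = (fun n => (@harmonic R n)^-1 *:
    ((f \o shift a) (@harmonic R n *: v) - f a))); last first.
  by apply/funext => n; rewrite /harmonic/= invrK.
apply: H; split => [n|]; first by rewrite /harmonic/= invr_eq0 pnatr_eq0.
exact: cvg_harmonic.
Qed.

(** A quadratic remainder gives existence and value of the derivative at once. It identifies the
    gradient of a risk without differentiation under the integral. *)
Lemma derive_of_quadratic_bound (V : normedModType R) (f : V -> R) a v m C :
  (forall h : R, `|f (h *: v + a) - f a - h * m| <= C * h ^+ 2) ->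
  'D_v f a = m.
Proof.
move=> H; apply/cvg_lim => //.
have C0 : 0 <= C by have := H 1; rewrite expr1n mulr1; apply: le_trans.
apply/cvgrPdist_le => e e0.
have e1 : 0 < e / (C + 1) by rewrite divr_gt0// ltr_wpDl.
near=> h.
have h0 : h != 0 by near: h; exact: nbhs_dnbhs_neq.
have -> : m - h^-1 *: ((f \o shift a) (h *: v) - f a) =
    - (h^-1 * (f (h *: v + a) - f a - h * m)).
  by rewrite /= [in RHS]mulrBr mulKf// opprB.
rewrite normrN normrM normfV.
rewrite ler_pdivrMl ?normr_gt0// (le_trans (H h))//.
rewrite -real_normK ?num_real// expr2 mulrCA ler_wpM2l//.
have hh : `|h| <= e / (C + 1).
  near: h; apply: dnbhs0_le; exact: e1.
apply: (@le_trans _ _ (C * (e / (C + 1)))); first by rewrite ler_wpM2l.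
rewrite mulrA ler_pdivrMr ?ltr_wpDl// mulrC ler_wpM2l ?(ltW e0)//; lra.
Unshelve. all: by end_near. Qed.

Variables (dw dth : nat) (F : 'rV[R]_dw -> 'rV[R]_dth -> R).

Let Fp (y : 'rV[R]_dw * 'rV[R]_dth) := F y.1 y.2.

Definition joint_grad (v : 'rV[R]_(dw + dth)) : 'rV[R]_(dw + dth) :=
  row_mx (grad_w F (lsubmx v) (rsubmx v)) (grad_th F (lsubmx v) (rsubmx v)).

Lemma derive_pairE w th (z : 'rV[R]_dw * 'rV[R]_dth) :
  differentiable Fp (w, th) ->
  'D_z Fp (w, th) = dot (grad_w F w th) z.1 + dot (grad_th F w th) z.2.
Proof.
move=> dF; rewrite deriveE//.
pose D := 'd Fp (w, th).
have zE : z = \sum_j z.1 0 j *: (delta_mx 0 j, 0) +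
              \sum_j z.2 0 j *: (0, delta_mx 0 j).
  have fst_sum (n : nat) (G : 'I_n -> 'rV[R]_dw * 'rV[R]_dth) :
    \sum_j G j = (\sum_j (G j).1, \sum_j (G j).2).
    by elim/big_rec3 : _ => // i x y z' _ ->.
  rewrite !fst_sum/=; case: z => z1 z2/=.
  rewrite [X in (_, X) + _]big1 ?[X in _ + (X, _)]big1; last 2 first.
  - by move=> j _; rewrite scaler0.
  - by move=> j _; rewrite scaler0.
  by rewrite -[RHS]/(_ + 0, 0 + _) addr0 add0r -!row_sum_delta.
have wE j : D (delta_mx 0 j, 0) = grad_w F w th 0 j.
  rewrite /D -deriveE// mxE; apply: (congr1 (fun g : R -> R => lim (g @ 0^'))).
  by apply/funext => h /=; rewrite /Fp/= scaler0 add0r.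
have thE j : D (0, delta_mx 0 j) = grad_th F w th 0 j.
  rewrite /D -deriveE// mxE; apply: (congr1 (fun g : R -> R => lim (g @ 0^'))).
  by apply/funext => h /=; rewrite /Fp/= scaler0 add0r.
rewrite [in LHS]zE linearD !linear_sum; congr (_ + _); apply: eq_bigr => j _.
  by rewrite linearZ/= -/D wE mulrC.
by rewrite linearZ/= -/D thE mulrC.
Qed.

(** By convexity each difference quotient from [a] towards [b] is at most F b - F a, and the
    quotients along 1/(n+1) tend to the directional derivative. *)
Lemma convex_subgradient : jointly_convex F ->
  (forall z, differentiable Fp z) ->
  subgradient (fun v => F (lsubmx v) (rsubmx v)) joint_grad.
Proof.
move=> cF dF x y.
pose a := (lsubmx x, rsubmx x); pose b := (lsubmx y, rsubmx y).
have -> : dot (joint_grad x) (y - x) = 'D_(b - a) Fp a.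
  by rewrite derive_pairE// -dot_row_mx /= -!linearB hsubmxK.
rewrite -lerBrDl -[leRHS]/(Fp b - Fp a).
have /derivable_cvg_seq H : derivable Fp a (b - a) by exact: diff_derivable.
rewrite -(cvg_lim _ H)//; apply: limr_le; first by apply/cvg_ex; eexists; exact: H.
apply: nearW => n; set h : R := n.+1%:R^-1.
have h0 : 0 < h by rewrite invr_gt0.
have h1 : h <= 1 by rewrite invf_le1 ?ler1n.
rewrite -ler_pdivlMl ?ltr0n// -/h lerBlDr.
have : Fp (h *: b + (1 - h) *: a) <= h * Fp b + (1 - h) * Fp a.
  exact: (cF (Itv01 (ltW h0) h1) b a (in_setT _) (in_setT _)).
have -> : h *: (b - a) + a = h *: b + (1 - h) *: a.
  by rewrite scalerBr scalerBl scale1r -addrA [in RHS](addrC a).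
by move/le_trans; apply; lra.
Qed.

Lemma smooth_lipschitz (L : R) : 0 <= L -> smooth L F ->
  lipschitz_l2 joint_grad L.
Proof.
move=> L0 [_ H] x y; rewrite /joint_grad.
have := H (lsubmx x) (lsubmx y) (rsubmx x) (rsubmx y).
rewrite !l2norm_dot -!dot_row_mx -!linearB/= hsubmxK.
rewrite -(@ler_pXn2r _ 2) ?nnegrE ?mulr_ge0 ?sqrtr_ge0// exprMn.
by rewrite !sqr_sqrtr ?dot_ge0// opp_row_mx add_row_mx.
Qed.

End Calculus.

(** * One step of the algorithm *)

Section Step.
Context {R : realType} {N dw dth : nat}.
Local Notation D := (dw + dth)%N.
Implicit Types (z : params R dw N dth) (g h : 'I_N -> 'rV[R]_D).

Definition user_point z (i : 'I_N) : 'rV[R]_D := row_mx z.1 (row i z.2).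

(** For [alpha = 0] the convention [0^-1 = 0] drops the w-part, which agrees with the extended norm
    exactly when [z.1 = 0]. *)
Definition nsq (alpha : R) z : R :=
  alpha^-1 * dot z.1 z.1 + \sum_i dot (row i z.2) (row i z.2).

Definition avg_lsub g : 'rV[R]_dw := N%:R^-1 *: \sum_i lsubmx (g i).

Definition step (eta alpha : R) z g (v : 'rV[R]_dw) : params R dw N dth :=
  (z.1 - (alpha * eta) *: (avg_lsub g + v),
   \matrix_(i < N) (row i z.2 - (eta / N%:R) *: rsubmx (g i))).

Lemma nsq_ge0 alpha z : 0 <= alpha -> 0 <= nsq alpha z.
Proof.
move=> a0; rewrite addr_ge0 ?mulr_ge0 ?invr_ge0 ?dot_ge0//.
by apply: sumr_ge0 => i _; exact: dot_ge0.
Qed.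

(** The factor alpha in the w-step cancels the weight 1/alpha, so the cross terms of w and theta
    combine into inner products with the full user gradients. For [alpha = 0] there is no
    cancellation, and the w-part has to vanish. The terms linear in [v] are grouped because they
    will have mean 0. *)
Lemma step_nsq eta alpha z zs g v : (alpha = 0 -> z.1 = zs.1) ->
  nsq alpha (step eta alpha z g v - zs) = nsq alpha (z - zs)
    - 2%:R * eta * (N%:R^-1 * \sum_i dot (g i) (user_point z i - user_point zs i))
    + alpha * eta ^+ 2 * dot (avg_lsub g) (avg_lsub g)
    + (eta / N%:R) ^+ 2 * \sum_i dot (rsubmx (g i)) (rsubmx (g i))
    + alpha * eta ^+ 2 * dot v v
    + dot ((2%:R * alpha * eta ^+ 2) *: avg_lsub g
           - (2%:R * eta) *: (z.1 - zs.1)) v.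
Proof.
move=> az.
set u := avg_lsub g; set de := z.1 - zs.1.
pose De i := row i z.2 - row i zs.2.
have gE : N%:R^-1 * \sum_i dot (g i) (user_point z i - user_point zs i) =
    dot u de + N%:R^-1 * \sum_i dot (rsubmx (g i)) (De i).
  rewrite /u /avg_lsub dotZl dot_suml -mulrDr -big_split/=; congr (_ * _).
  apply: eq_bigr => i _; rewrite /user_point opp_row_mx add_row_mx.
  by rewrite (dot_submx (g i)) row_mxKl row_mxKr.
have DeE i : row i z.2 - row i zs.2 = De i by [].
have deE : z.1 - zs.1 = de by [].
have de0 : alpha = 0 -> de = 0 by move=> a0; rewrite -deE az// subrr.
have uE : avg_lsub g = u by [].
clearbody u de De.
have wE : alpha^-1 * dot (de - (alpha * eta) *: (u + v))
      (de - (alpha * eta) *: (u + v)) =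
    alpha^-1 * dot de de - 2%:R * eta * dot u de - 2%:R * eta * dot de v
    + alpha * eta ^+ 2 * (dot u u + 2%:R * dot u v + dot v v).
  have [a0|a0] := eqVneq alpha 0.
    by rewrite (de0 a0) a0 !mul0r scale0r subr0 !dotE !mulr0 ?mul0r; ring.
  by rewrite !dotE (dotC v u) (dotC u de) (dotC v de); field.
have tE : \sum_i dot (De i - (eta / N%:R) *: rsubmx (g i))
      (De i - (eta / N%:R) *: rsubmx (g i)) =
    \sum_i dot (De i) (De i)
    - 2%:R * (eta / N%:R) * \sum_i dot (rsubmx (g i)) (De i)
    + (eta / N%:R) ^+ 2 * \sum_i dot (rsubmx (g i)) (rsubmx (g i)).
  rewrite !mulr_sumr -sumrB -big_split/=; apply: eq_bigr => i _.
  by rewrite !dotE (dotC (rsubmx (g i)) (De i)); ring.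
have s1 : (step eta alpha z g v - zs).1 = de - (alpha * eta) *: (u + v).
  by rewrite -[LHS]/(z.1 - (alpha * eta) *: (avg_lsub g + v) - zs.1) uE -deE addrAC.
have s2 i : row i (step eta alpha z g v - zs).2 =
    De i - (eta / N%:R) *: rsubmx (g i).
  rewrite -[X in row i X]/((step eta alpha z g v).2 - zs.2) linearB/= rowK.
  by rewrite -DeE addrAC.
have z2 i : row i (z - zs).2 = De i.
  by rewrite -[X in row i X]/(z.2 - zs.2) linearB DeE.
rewrite gE /nsq s1 wE; under eq_bigr do rewrite s2.
rewrite tE -[X in _ = _ * dot X X + _ - _ + _ + _ + _ + _]/(z.1 - zs.1) deE.
under [in RHS]eq_bigr do rewrite z2.
rewrite dotDl dotNl !dotZl; ring.
Qed.

(** Here [h] stands for the gradients at [zs] and [a] for the sample loss gaps. Jensen over users is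
    applied to g - h only: the w-noise stays the squared norm of an average, which independence
    later makes smaller by a factor N. The theta-noise gets this factor from the step [eta / N]. *)
Lemma step_le eta alpha L z zs g h v (a : 'I_N -> R) :
  (0 < N)%N -> 0 <= alpha -> 0 <= eta -> 0 < L ->
  4%:R * L * Num.max alpha N%:R^-1 * eta <= 1 ->
  (alpha = 0 -> z.1 = zs.1) ->
  (forall i, a i + (4%:R * L)^-1 * dot (g i - h i) (g i - h i)
    <= dot (g i) (user_point z i - user_point zs i)) ->
  nsq alpha (step eta alpha z g v - zs) + 2%:R * eta * (N%:R^-1 * \sum_i a i)
  <= nsq alpha (z - zs)
    + 2%:R * alpha * eta ^+ 2 * dot (avg_lsub h) (avg_lsub h)
    + 2%:R * (eta / N%:R) ^+ 2 * \sum_i dot (rsubmx (h i)) (rsubmx (h i))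
    + alpha * eta ^+ 2 * dot v v
    + dot ((2%:R * alpha * eta ^+ 2) *: avg_lsub g
           - (2%:R * eta) *: (z.1 - zs.1)) v.
Proof.
move=> N0 a0 e0 L0 etaL az ha; rewrite step_nsq//.
set Bw := N%:R^-1 * \sum_i dot (lsubmx (g i - h i)) (lsubmx (g i - h i)).
set Bt := N%:R^-1 * \sum_i dot (rsubmx (g i - h i)) (rsubmx (g i - h i)).
have N0' : 0 < (N%:R : R) by rewrite ltr0n.
have Ni0 : 0 <= (N%:R : R)^-1 by rewrite invr_ge0 ltW.
have Bw0 : 0 <= Bw by rewrite mulr_ge0// sumr_ge0// => i _; exact: dot_ge0.
have Bt0 : 0 <= Bt by rewrite mulr_ge0// sumr_ge0// => i _; exact: dot_ge0.
set C := N%:R^-1 * \sum_i dot (g i) (user_point z i - user_point zs i).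
set A := N%:R^-1 * \sum_i a i.
have CA : A + (4%:R * L)^-1 * (Bw + Bt) <= C.
  rewrite /A /Bw /Bt /C -mulrDr mulrCA -mulrDr ler_wpM2l//.
  rewrite -big_split/= mulr_sumr -big_split/=; apply: ler_sum => i _.
  by rewrite -dot_submx; exact: ha.
have UB : dot (avg_lsub g) (avg_lsub g) <=
    2%:R * Bw + 2%:R * dot (avg_lsub h) (avg_lsub h).
  apply: (le_trans (dotB_le _ (avg_lsub h))); rewrite lerD2r ler_wpM2l//.
  have -> : avg_lsub g - avg_lsub h = N%:R^-1 *: \sum_i lsubmx (g i - h i).
    by rewrite /avg_lsub -scalerBr -sumrB; under eq_bigr do rewrite -linearB.
  exact: dot_avg_le.
set Tg := \sum_i dot (rsubmx (g i)) (rsubmx (g i)).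
set Th := \sum_i dot (rsubmx (h i)) (rsubmx (h i)).
have TB : (eta / N%:R) ^+ 2 * Tg <=
    2%:R * eta ^+ 2 * N%:R^-1 * Bt + 2%:R * (eta / N%:R) ^+ 2 * Th.
  have -> : 2%:R * eta ^+ 2 * N%:R^-1 * Bt + 2%:R * (eta / N%:R) ^+ 2 * Th =
      (eta / N%:R) ^+ 2 * \sum_i (2%:R * dot (rsubmx (g i - h i)) (rsubmx (g i - h i))
        + 2%:R * dot (rsubmx (h i)) (rsubmx (h i))).
    by rewrite big_split/= -!mulr_sumr /Bt /Th; ring.
  rewrite ler_wpM2l ?sqr_ge0// ler_sum// => i _; rewrite linearB.
  exact: dotB_le.
have c0 : 0 < 4%:R * L by rewrite mulr_gt0.
(* This is where max(alpha, 1/N) originates: the second order terms in |g - h|^2 carry alpha for w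
   and 1/N for theta, and the same gain 2 eta/(4L) has to absorb both. *)
have M x : 0 <= x -> x <= Num.max alpha N%:R^-1 ->
    2%:R * eta ^+ 2 * x <= 2%:R * eta * (4%:R * L)^-1.
  move=> x0 xM; have H : x * eta <= (4%:R * L)^-1.
    rewrite -(ler_pM2l c0) mulfV ?gt_eqF// (le_trans _ etaL)// mulrA.
    by rewrite ler_wpM2r// ler_wpM2l// ltW.
  have := ler_wpM2l e0 H; nra.
have aM : alpha <= Num.max alpha N%:R^-1 by rewrite le_max lexx.
have NM : N%:R^-1 <= Num.max alpha N%:R^-1 by rewrite le_max lexx orbT.
have H1 := ler_wpM2r Bw0 (M _ a0 aM).
have H2 := ler_wpM2r Bt0 (M _ Ni0 NM).
have H3 : 2%:R * eta * (A + (4%:R * L)^-1 * (Bw + Bt)) <= 2%:R * eta * C.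
  by rewrite ler_wpM2l// mulr_ge0.
have H4 : alpha * eta ^+ 2 * dot (avg_lsub g) (avg_lsub g) <=
    alpha * eta ^+ 2 * (2%:R * Bw + 2%:R * dot (avg_lsub h) (avg_lsub h)).
  by rewrite ler_wpM2l// mulr_ge0 ?sqr_ge0.
rewrite -/Tg -/Th -/A -/C.
move: H1 H2 H3 H4 TB.
set Z := (4%:R * L)^-1; set U := dot (avg_lsub g) _; set H := dot (avg_lsub h) _.
set W := dot (_ - _) v; set V := dot v v; set Y := (eta / N%:R) ^+ 2.
set I := N%:R^-1; set S := nsq _ _.
clearbody Z U H W V Y I S Tg Th A C Bw Bt.
rewrite !mulrDr !mulrA.
lra.
Qed.

End Step.

(** * Square integrable variables and independent sources *)

Section SquareIntegrable.
Context {R : realType} {d} {Om : measurableType d} (P : probability Om R).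
Implicit Types (Y W : Om -> R).

Definition square_integrable Y : Prop :=
  measurable_fun setT Y /\ P.-integrable setT (fun o => (Y o ^+ 2)%:E).

Local Notation L2 := square_integrable.

Lemma integrable_real_le Y W : measurable_fun setT Y ->
  P.-integrable setT (EFin \o W) -> (forall o, `|Y o| <= W o) ->
  P.-integrable setT (EFin \o Y).
Proof.
move=> mY iW YW; apply: (le_integrable measurableT _ _ iW) => //.
  exact/measurable_EFinP.
move=> o _; rewrite /= lee_fin (le_trans (YW o))//.
exact: ler_norm.
Qed.

Lemma integrable_realD Y W : P.-integrable setT (EFin \o Y) ->
  P.-integrable setT (EFin \o W) ->
  P.-integrable setT (EFin \o (fun o => Y o + W o)).
Proof. by move=> iY iW; exact: (integrableD measurableT iY iW). Qed.

Lemma integrable_realB Y W : P.-integrable setT (EFin \o Y) ->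
  P.-integrable setT (EFin \o W) ->
  P.-integrable setT (EFin \o (fun o => Y o - W o)).
Proof. by move=> iY iW; exact: (integrableB measurableT iY iW). Qed.

Lemma integrable_realZ a Y : P.-integrable setT (EFin \o Y) ->
  P.-integrable setT (EFin \o (fun o => a * Y o)).
Proof. by move=> iY; exact: (integrableZl measurableT a iY). Qed.

Lemma integrable_real_sum (I : Type) (r : seq I) (Q : pred I) (Y : I -> Om -> R) :
  (forall i, Q i -> P.-integrable setT (EFin \o Y i)) ->
  P.-integrable setT (EFin \o (fun o => \sum_(i <- r | Q i) Y i o)).
Proof.
move=> iY; rewrite (_ : _ \o _ =
    fun o => (\sum_(i <- r | Q i) (EFin \o Y i) o)%E).
  exact: integrable_sum.
by apply/funext => o; rewrite /= sumEFin.
Qed.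

Lemma integrable_real_cst (a : R) : P.-integrable setT (EFin \o cst a).
Proof. exact: finite_measure_integrable_cst. Qed.

Lemma Rintegral_sum (I : Type) (r : seq I) (Q : pred I) (Y : I -> Om -> R) :
  (forall i, Q i -> P.-integrable setT (EFin \o Y i)) ->
  \int[P]_o (\sum_(i <- r | Q i) Y i o) = \sum_(i <- r | Q i) \int[P]_o Y i o.
Proof.
move=> iY; elim: r => [|i r IH].
  under eq_Rintegral do rewrite big_nil.
  by rewrite big_nil Rintegral_cst// mul0r.
under eq_Rintegral do rewrite big_cons; rewrite big_cons.
case: ifPn => // Qi; rewrite RintegralD ?IH//; first exact: iY.
exact: integrable_real_sum.
Qed.

Lemma Rintegral_prob_cst (a : R) : \int[P]_o a = a.
Proof.
rewrite Rintegral_cst// [X in fine X](_ : _ = 1%E) ?mulr1//.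
exact: probability_setT.
Qed.

Lemma L2_measurable Y : L2 Y -> measurable_fun setT Y. Proof. by case. Qed.

Lemma L2_integrable Y : L2 Y -> P.-integrable setT (EFin \o Y).
Proof. by case=> mY; exact: sq_integrable. Qed.

Lemma L2_dominated Y W : measurable_fun setT Y ->
  P.-integrable setT (EFin \o W) -> (forall o, Y o ^+ 2 <= W o) -> L2 Y.
Proof.
move=> mY iW YW; split => //.
apply: (@integrable_real_le (fun o => Y o ^+ 2) W) => //.
  exact: measurable_funX.
by move=> o; rewrite ger0_norm ?sqr_ge0.
Qed.

Lemma L2_cst a : L2 (cst a).
Proof. by split => //; exact: (integrable_real_cst (a ^+ 2)). Qed.

Lemma L2D Y W : L2 Y -> L2 W -> L2 (fun o => Y o + W o).
Proof.
move=> [mY iY] [mW iW].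
apply: (@L2_dominated _ (fun o => 2%:R * Y o ^+ 2 + 2%:R * W o ^+ 2)).
- exact: measurable_funD.
- by apply: integrable_realD; exact: integrable_realZ.
- by move=> o; have := sqr_ge0 (Y o - W o); nra.
Qed.

Lemma L2Z a Y : L2 Y -> L2 (fun o => a * Y o).
Proof.
move=> [mY iY]; apply: (@L2_dominated _ (fun o => a ^+ 2 * Y o ^+ 2)).
- exact: measurable_funM.
- exact: integrable_realZ.
- by move=> o; rewrite exprMn.
Qed.

Lemma L2B Y W : L2 Y -> L2 W -> L2 (fun o => Y o - W o).
Proof.
move=> LY LW; rewrite (_ : (fun o => _) = (fun o => Y o + -1 * W o)).
  by apply: L2D => //; exact: L2Z.
by apply/funext => o; rewrite mulN1r.
Qed.

Lemma L2_sum (I : Type) (r : seq I) (Y : I -> Om -> R) :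
  (forall i, L2 (Y i)) -> L2 (fun o => \sum_(i <- r) Y i o).
Proof.
move=> LY; elim: r => [|i r IH].
  by under eq_fun do rewrite big_nil; exact: L2_cst.
by under eq_fun do rewrite big_cons; exact: L2D.
Qed.

Lemma L2M_integrable Y W : L2 Y -> L2 W ->
  P.-integrable setT (EFin \o (fun o => Y o * W o)).
Proof.
move=> [mY iY] [mW iW].
apply: (@integrable_real_le _ (fun o => Y o ^+ 2 + W o ^+ 2)).
- exact: measurable_funM.
- exact: integrable_realD.
- move=> o; rewrite ler_norml; have := sqr_ge0 (Y o - W o).
  have := sqr_ge0 (Y o + W o); have := sqr_ge0 (Y o); have := sqr_ge0 (W o).
  by move=> *; apply/andP; split; nra.
Qed.

Definition vec_square_integrable k (u : Om -> 'rV[R]_k) : Prop :=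
  forall j, L2 (fun o => u o 0 j).

Local Notation vL2 := vec_square_integrable.

Lemma vL2_cst k (u : 'rV[R]_k) : vL2 (cst u).
Proof. by move=> j; exact: L2_cst. Qed.

Lemma vL2D k (u v : Om -> 'rV[R]_k) : vL2 u -> vL2 v -> vL2 (fun o => u o + v o).
Proof.
by move=> Lu Lv j; under eq_fun do rewrite mxE; exact: L2D (Lu j) (Lv j).
Qed.

Lemma vL2Z k a (u : Om -> 'rV[R]_k) : vL2 u -> vL2 (fun o => a *: u o).
Proof. by move=> Lu j; under eq_fun do rewrite mxE; exact: L2Z (Lu j). Qed.

Lemma vL2B k (u v : Om -> 'rV[R]_k) : vL2 u -> vL2 v -> vL2 (fun o => u o - v o).
Proof.
by move=> Lu Lv j; under eq_fun do rewrite !mxE; exact: L2B (Lu j) (Lv j).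
Qed.

Lemma vL2_sum k (I : Type) (r : seq I) (u : I -> Om -> 'rV[R]_k) :
  (forall i, vL2 (u i)) -> vL2 (fun o => \sum_(i <- r) u i o).
Proof.
move=> Lu j; under eq_fun do rewrite summxE.
by apply: L2_sum => i; exact: Lu.
Qed.

Lemma vL2_lsubmx m k (u : Om -> 'rV[R]_(m + k)) :
  vL2 u -> vL2 (fun o => lsubmx (u o)).
Proof. by move=> Lu j; under eq_fun do rewrite mxE; exact: Lu. Qed.

Lemma vL2_rsubmx m k (u : Om -> 'rV[R]_(m + k)) :
  vL2 u -> vL2 (fun o => rsubmx (u o)).
Proof. by move=> Lu j; under eq_fun do rewrite mxE; exact: Lu. Qed.

Lemma vL2_row_mx m k (u : Om -> 'rV[R]_m) (v : Om -> 'rV[R]_k) :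
  vL2 u -> vL2 v -> vL2 (fun o => row_mx (u o) (v o)).
Proof.
move=> Lu Lv j; rewrite -[j]splitK; case: (fintype.split j) => i /=.
  by under eq_fun do rewrite row_mxEl; exact: Lu.
by under eq_fun do rewrite row_mxEr; exact: Lv.
Qed.

Lemma vL2_dot_integrable k (u v : Om -> 'rV[R]_k) : vL2 u -> vL2 v ->
  P.-integrable setT (EFin \o (fun o => dot (u o) (v o))).
Proof.
move=> Lu Lv; apply: integrable_real_sum => j _.
exact: L2M_integrable (Lu j) (Lv j).
Qed.

Lemma vL2_dominated k (u : Om -> 'rV[R]_k) W :
  (forall j, measurable_fun setT (fun o => u o 0 j)) ->
  P.-integrable setT (EFin \o W) -> (forall o, dot (u o) (u o) <= W o) -> vL2 u.
Proof.
move=> mu iW uW j; apply: (L2_dominated (mu j) iW) => o.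
exact: le_trans (dot_coord_le _ _) (uW o).
Qed.

End SquareIntegrable.

Section IndependentSource.
Context {R : realType} {d d2} {Om : measurableType d} {T2 : measurableType d2}
  (P : probability Om R).
Variables (I : finType) (F : I -> set_system Om).
Hypotheses (F_indep : mutually_independent P F)
  (F_meas : forall k, F k `<=` measurable)
  (FI : forall k, setI_closed (F k)).
Variables (k : I) (X2 : {RV P >-> T2}).
Hypothesis (FX : F k = sigma_of X2).

Definition others (k : I) : {set I} := (~: [set k])%SET.

(* The carrier is [Om] itself, so that the identity map stands for the family of
   all sources but [k]. *)
Definition other_sources := g_sigma_algebraType (cylinder F (others k)).

Let X1 : Om -> other_sources := id.

Let mX1 : measurable_fun setT X1.
Proof.
by move=> _ A mA; rewrite setTI; exact: sigma_cylinder_measurable mA.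
Qed.

HB.instance Definition _ := isMeasurableFun.Build _ _ _ _ X1 mX1.

Let X12_indep A B : measurable A -> measurable B ->
  P (X1 @^-1` A `&` X2 @^-1` B) = (P (X1 @^-1` A) * P (X2 @^-1` B))%E.
Proof.
move=> mA mB.
have kJ : k \notin others k by rewrite /others !inE eqxx.
have FC : F k (X2 @^-1` B) by rewrite FX; exists B => //; rewrite setTI.
exact: (sigma_cylinder_indep F_indep F_meas FI kJ mA FC).
Qed.

(** This takes the place of conditioning on the past: [h] may depend on every source except [k], and
    source [k] is integrated out against its law. *)
Lemma source_integral (h : Om -> T2 -> R) (H : Om -> R) :
  measurable_fun setT (fun p : other_sources * T2 => h p.1 p.2) ->
  P.-integrable setT (EFin \o (fun o => h o (X2 o))) ->
  (forall o, (distribution P X2).-integrable setT (EFin \o h o)) ->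
  (forall o, \int[distribution P X2]_x h o x = H o) ->
  P.-integrable setT (EFin \o H) /\ \int[P]_o h o (X2 o) = \int[P]_o H o.
Proof.
move=> mh ih ih2 hH.
pose h' (p : other_sources * T2) := h p.1 p.2.
have := indep_inner_integrable (X1 := X1) X12_indep (h := h') mh ih ih2.
have := indep_integral (X1 := X1) X12_indep (h := h') mh ih ih2.
rewrite /h'/= => E1 E2; split.
  by apply: eq_integrable E2 => // o _ /=; rewrite hH.
by rewrite E1; apply: eq_Rintegral => o _; exact: hH.
Qed.

(** Applied to the server noise and to the deviations of two distinct users. *)
Lemma source_integral_mul0 (Y : Om -> R) (W : T2 -> R) :
  measurable_fun setT (Y : other_sources -> R) -> measurable_fun setT W ->
  square_integrable P Y -> square_integrable P (W \o X2) ->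
  \int[P]_o W (X2 o) = 0 -> \int[P]_o (Y o * W (X2 o)) = 0.
Proof.
move=> mY mW LY LW W0.
have mW' : measurable_fun setT (EFin \o W) by exact/measurable_EFinP.
have iWX : P.-integrable setT ((EFin \o W) \o X2) by exact: L2_integrable LW.
have iW : (distribution P X2).-integrable setT (EFin \o W).
  exact: integrable_pushforward.
have [] // := @source_integral (fun o x => Y o * W x) (cst 0) _ _ _ _.
- apply: measurable_funM; first exact: measurableT_comp mY _.
  exact: measurableT_comp.
- exact: L2M_integrable LY LW.
- by move=> o; exact: integrable_realZ.
- move=> o; rewrite RintegralZl// /Rintegral integral_distribution//.
  by rewrite -[fine _]/(\int[P]_o W (X2 o)) W0 mulr0.
- by move=> _ ->; rewrite Rintegral_prob_cst.
Qed.

End IndependentSource.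

(** * The iterates as random variables *)

Section Continuity.
Context {R : realType} {d : nat}.
Implicit Types (u v : nat -> 'rV[R]_d).

Lemma cvg_dot u v (a b : 'rV[R]_d) :
  (forall j, u n 0 j @[n --> \oo] --> a 0 j) ->
  (forall j, v n 0 j @[n --> \oo] --> b 0 j) ->
  dot (u n) (v n) @[n --> \oo] --> dot a b.
Proof.
move=> ua vb; rewrite /dot; elim: (index_enum _) => [|j r IH].
  by rewrite big_nil; under eq_fun do rewrite big_nil; exact: cvg_cst.
rewrite big_cons; under eq_fun do rewrite big_cons.
by apply: cvgD => //; apply: cvgM.
Qed.

Variables (f : 'rV[R]_d -> R) (g : 'rV[R]_d -> 'rV[R]_d) (L : R).
Hypotheses (L_gt0 : 0 < L) (fg : subgradient f g) (gL : lipschitz_l2 g L).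
Variables (v : nat -> 'rV[R]_d) (b : 'rV[R]_d).
Hypothesis vb : forall j, v n 0 j @[n --> \oo] --> b 0 j.

Let vb0 j : (v n - b) 0 j @[n --> \oo] --> (0 : 'rV[R]_d) 0 j.
Proof.
under eq_fun do rewrite !mxE; rewrite mxE -(subrr (b 0 j)).
by apply: cvgB => //; exact: cvg_cst.
Qed.

Let dist0 : dot (v n - b) (v n - b) @[n --> \oo] --> (0 : R).
Proof. by have := cvg_dot vb0 vb0; rewrite dot0l. Qed.

Lemma lipschitz_cvg j : g (v n) 0 j @[n --> \oo] --> g b 0 j.
Proof.
apply/cvgrPdist_le => e e0.
have e1 : 0 < e ^+ 2 / L ^+ 2 by rewrite divr_gt0 ?exprn_gt0.
move/cvgrPdist_le : dist0 => /(_ _ e1); apply: filterS => n.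
rewrite sub0r normrN ger0_norm ?dot_ge0// => H.
rewrite -(@ler_pXn2r _ 2) ?nnegrE ?normr_ge0 ?(ltW e0)// real_normK ?num_real//.
have -> : g b 0 j - g (v n) 0 j = - (g (v n) - g b) 0 j by rewrite !mxE opprB.
rewrite sqrrN; apply: (le_trans (dot_coord_le (g (v n) - g b) j)).
apply: (le_trans (gL _ _)).
by rewrite mulrC -ler_pdivlMr ?exprn_gt0.
Qed.

(** The values are squeezed between the linear lower bound and the quadratic upper bound at [b]. *)
Lemma subgradient_cvg : f (v n) @[n --> \oo] --> f b.
Proof.
have c1 : f b + dot (g b) (v n - b) @[n --> \oo] --> f b.
  rewrite -[X in _ --> X]addr0 -(dot0r (g b)); apply: cvgD; first exact: cvg_cst.
  by apply: (@cvg_dot (fun=> g b)) => // j; exact: cvg_cst.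
have c2 : f b + dot (g b) (v n - b) + L * dot (v n - b) (v n - b)
    @[n --> \oo] --> f b.
  rewrite -[X in _ --> X]addr0 -(mulr0 L); apply: cvgD => //.
  by apply: cvgM => //; exact: cvg_cst.
apply: squeeze_cvgr c1 c2; apply: nearW => n; apply/andP; split; first exact: fg.
exact: (subgradient_upper L_gt0 fg gL).
Qed.

End Continuity.

Section Sources.
Context {R : realType} {d} {Om : measurableType d} (P : probability Om R).

Lemma sigma_of_setT d' (T : measurableType d') (X : Om -> T) :
  sigma_of X setT.
Proof. by exists setT => //; rewrite preimage_setT setIT. Qed.

Lemma sigma_of_setI_closed d' (T : measurableType d') (X : Om -> T) :
  setI_closed (sigma_of X).
Proof.
move=> _ _ [A mA <-] [B mB <-]; exists (A `&` B); first exact: measurableI.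
by rewrite !setTI preimage_setI.
Qed.

Lemma sigma_of_measurable d' (T : measurableType d') (X : {RV P >-> T}) :
  sigma_of X `<=` measurable.
Proof. by move=> _ [A mA <-]; exact: (measurable_funPT X). Qed.

Lemma other_source_measurable (I : finType) (F : I -> set_system Om) (k j : I)
    d' (T : measurableType d') (X : Om -> T) :
  j != k -> F j = sigma_of X -> (forall i, F i setT) ->
  measurable_fun setT (X : other_sources F k -> T).
Proof.
move=> jk Fj FT _ B mB; rewrite setTI; apply: sub_sigma_algebra.
apply: (cylinder_single FT (k := j)); first by rewrite /others !inE.
by rewrite Fj; exists B => //; rewrite setTI.
Qed.

Lemma has_law_integrable d' (T : measurableType d') (X : {RV P >-> T})
    (Q : probability T R) (W : T -> R) : has_law X Q ->
  measurable_fun setT W -> Q.-integrable setT (EFin \o W) ->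
  P.-integrable setT (EFin \o (W \o X)).
Proof.
move=> XQ mW /integrableP[mW' iW]; apply/integrableP; split.
  exact: measurableT_comp mW' _.
rewrite -(ge0_integral_distribution X (f := fun a => `|(EFin \o W) a|%E))//.
  rewrite (eq_measure_integral Q)// => A mA _; exact: XQ.
exact: measurableT_comp.
Qed.

Lemma has_law_distribution_integrable d' (T : measurableType d')
    (X : {RV P >-> T}) (Q : probability T R) (W : T -> R) : has_law X Q ->
  Q.-integrable setT (EFin \o W) ->
  (distribution P X).-integrable setT (EFin \o W).
Proof.
move=> XQ /integrableP[mW iW]; apply/integrableP; split => //.
by rewrite (eq_measure_integral Q)// => A mA _; exact: XQ.
Qed.

Lemma has_law_distribution_integral d' (T : measurableType d')
    (X : {RV P >-> T}) (Q : probability T R) (W : T -> R) : has_law X Q ->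
  \int[distribution P X]_x W x = \int[Q]_x W x.
Proof.
move=> XQ; congr fine; apply: eq_measure_integral => A mA _; exact: XQ.
Qed.

Lemma has_law_integral d' (T : measurableType d') (X : {RV P >-> T})
    (Q : probability T R) (W : T -> R) : has_law X Q ->
  measurable_fun setT W -> Q.-integrable setT (EFin \o W) ->
  \int[P]_o W (X o) = \int[Q]_x W x.
Proof.
move=> XQ mW iW; rewrite -(has_law_distribution_integral _ XQ).
congr fine; rewrite integral_distribution//; first exact/measurable_EFinP.
exact: has_law_integrable XQ mW iW.
Qed.

End Sources.

Section Process.
Context {R : realType} {dX} {X : measurableType dX} {N dw dth : nat}.
Local Notation D := (dw + dth)%N.
Variables (g : 'I_N -> 'rV[R]_D -> X -> 'rV[R]_D) (eta alpha : R).

(** PPSGD without clipping, driven by abstract gradient maps; on the modified losses clipping does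
    nothing, so this is the algorithm actually analysed. *)
Fixpoint sgd (x : 'I_N -> nat -> X) (v : nat -> 'rV[R]_dw) (t : nat) :
    params R dw N dth :=
  if t is t'.+1 then
    let z := sgd x v t' in
    step eta alpha z (fun i => g i (user_point z i) (x i t)) (v t)
  else (0, 0).

Lemma sgd_alpha0 x v t : alpha = 0 -> (sgd x v t).1 = 0.
Proof. by move=> a0; elim: t => //= t ->; rewrite a0 mul0r scale0r subr0. Qed.

Variable L : R.
Hypotheses (L_gt0 : 0 < L)
  (mg : forall i v j, measurable_fun setT (fun x => g i v x 0 j))
  (gL : forall i x, lipschitz_l2 (g i ^~ x) L).

Section Measurability.
Context {dT} {T : measurableType dT}.

Lemma grad_measurable i (u : T -> 'rV[R]_D) (x : T -> X) j :
  (forall j, measurable_fun setT (fun o => u o 0 j)) ->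
  measurable_fun setT x ->
  measurable_fun setT (fun o => g i (u o) (x o) 0 j).
Proof.
move=> mu mx; apply: (caratheodory_measurable (phi := fun v x => g i v x 0 j)) => //.
by move=> y v_ v vv; exact: (lipschitz_cvg L_gt0 (gL i y)).
Qed.

Lemma user_point_measurable (z : T -> params R dw N dth) i j :
  (forall j, measurable_fun setT (fun o => (z o).1 0 j)) ->
  (forall i j, measurable_fun setT (fun o => (z o).2 i j)) ->
  measurable_fun setT (fun o => user_point (z o) i 0 j).
Proof.
move=> m1 m2; rewrite -[j]splitK /user_point; case: (fintype.split j) => k /=.
  by under eq_fun do rewrite row_mxEl; exact: m1.
by under eq_fun do rewrite row_mxEr mxE; exact: m2.
Qed.

Variables (x : T -> 'I_N -> nat -> X) (v : T -> nat -> 'rV[R]_dw).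

(** The domain [T] is left open because it is taken both as [Om] and as [other_sources]; on the
    latter only the sources of index below [t] can be expected to be measurable. *)
Lemma sgd_measurable t :
  (forall i s, (s < t)%N -> measurable_fun setT (fun o => x o i s.+1)) ->
  (forall s j, (s < t)%N -> measurable_fun setT (fun o => v o s.+1 0 j)) ->
  (forall j, measurable_fun setT (fun o => (sgd (x o) (v o) t).1 0 j)) /\
  (forall i j, measurable_fun setT (fun o => (sgd (x o) (v o) t).2 i j)).
Proof.
elim: t => [|t IH] mx mv; first by split => *; exact: measurable_cst.
have [||m1 m2] := IH.
- by move=> i s st; apply: mx; exact: ltnW.
- by move=> s j st; apply: mv; exact: ltnW.
have mgr i j : measurable_fun setT (fun o =>
    g i (user_point (sgd (x o) (v o) t) i) (x o i t.+1) 0 j).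
  apply: grad_measurable; last exact: mx.
  by move=> k; exact: user_point_measurable.
split => [j|i j] /=.
  under eq_fun do rewrite !mxE summxE; under eq_fun do under eq_bigr do rewrite mxE.
  apply: measurable_funB => //; apply: measurable_funM => //.
  apply: measurable_funD; last exact: mv.
  by apply: measurable_funM => //; apply: measurable_sum => i; exact: mgr.
under eq_fun do rewrite !mxE.
apply: measurable_funB => //; apply: measurable_funM => //; exact: mgr.
Qed.

Lemma sgd_point_measurable t i j :
  (forall i s, (s < t)%N -> measurable_fun setT (fun o => x o i s.+1)) ->
  (forall s j, (s < t)%N -> measurable_fun setT (fun o => v o s.+1 0 j)) ->
  measurable_fun setT (fun o => user_point (sgd (x o) (v o) t) i 0 j).
Proof.
move=> mx mv; have [m1 m2] := sgd_measurable mx mv.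
exact: user_point_measurable.
Qed.

End Measurability.

End Process.

(** * Expected descent *)

Section Core.
Context {R : realType} {dX} {X : measurableType dX} {N dw dth n : nat}.
Local Notation D := (dw + dth)%N.
Context {dOm} {Om : measurableType dOm} (P : probability Om R).
Variables (Pi : 'I_N -> probability X R).
Variables (xi : 'I_N -> nat -> {RV P >-> X}) (zeta : nat -> {RV P >-> dw.-tuple R}).
Variables (f : 'I_N -> 'rV[R]_D -> X -> R) (g : 'I_N -> 'rV[R]_D -> X -> 'rV[R]_D).
Variables (eta alpha L sigma_zeta : R) (zs : params R dw N dth).
Hypotheses (N_gt0 : (0 < N)%N) (alpha_ge0 : 0 <= alpha) (eta_ge0 : 0 <= eta)
  (L_gt0 : 0 < L).
Hypotheses
  (xi_law : forall i (t : 'I_n), has_law (xi i t.+1) (Pi i))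
  (zeta_law : forall t : 'I_n, isotropic_gaussian sigma_zeta (zeta t.+1))
  (indep : mutually_independent P (source_sigma (n := n) xi zeta)).
Hypotheses
  (f_int : forall i v, (Pi i).-integrable setT (EFin \o f i v))
  (mg : forall i v j, measurable_fun setT (fun x => g i v x 0 j))
  (fg : forall i x, subgradient (f i ^~ x) (g i ^~ x))
  (gL : forall i x, lipschitz_l2 (g i ^~ x) L).

Let ps i := user_point zs i.

Hypothesis hs_int : forall i,
  (Pi i).-integrable setT (EFin \o (fun x => dot (g i (ps i) x) (g i (ps i) x))).

Let src := source_sigma (n := n) xi zeta.
Let v om t : 'rV[R]_dw := row_of_tuple (zeta t om).
Let Z t om := sgd g eta alpha (fun i t => xi i t om) (v om) t.
Let up t i om := user_point (Z t om) i.
Let gr t i om := g i (up t i om) (xi i t.+1 om).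
Let hs t i om := g i (ps i) (xi i t.+1 om).
Local Notation vL2 := (vec_square_integrable P).

Let src_meas k : src k `<=` measurable.
Proof. by case: k => [it|t]; exact: sigma_of_measurable. Qed.

Let srcT k : src k setT.
Proof. by case: k => [it|t]; exact: sigma_of_setT. Qed.

Let srcI k : setI_closed (src k).
Proof. by case: k => [it|t]; exact: sigma_of_setI_closed. Qed.

Let tnth_meas j : measurable_fun setT (fun u : dw.-tuple R => tnth u j).
Proof. exact: measurable_tnth. Qed.

Let v_meas t j : measurable_fun setT (fun om => v om t 0 j).
Proof.
rewrite /v; under eq_fun do rewrite mxE.
exact: measurableT_comp (tnth_meas j) (measurable_funPT (zeta t)).
Qed.

Let noise_moments t j : (t < n)%N ->
  [/\ square_integrable P (fun om => v om t.+1 0 j),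
     \int[P]_om (v om t.+1 0 j ^+ 2) <= 2%:R * sigma_zeta ^+ 2 &
     \int[P]_om v om t.+1 0 j = 0].
Proof.
move=> tn; have [_ /(_ j)] := zeta_law (Ordinal tn); rewrite [nat_of_ord _]/=.
have mY : measurable_fun setT
    ((fun om => v om t.+1 0 j) : Om -> measurableTypeR R) by exact: v_meas.
pose Y : {RV P >-> measurableTypeR R} :=
  @mfun_Sub _ _ Om (measurableTypeR R) _ (mem_set mY).
have YE om : Y om = v om t.+1 0 j by [].
move=> Hlaw; have [] := @centered_normal_moments R _ _ P Y sigma_zeta.
  move=> B mB; rewrite -Hlaw//; congr (P (_ @^-1` B)).
  by apply/funext => om; rewrite YE /v mxE.
by move=> ? ? ?; split.
Qed.

Let v_L2 t : (t < n)%N -> vL2 (fun om => v om t.+1).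
Proof. by move=> tn j; have [] := noise_moments j tn. Qed.

Let hs_L2 t i : (t < n)%N -> vL2 (hs t i).
Proof.
move=> tn; have law := xi_law i (Ordinal tn).
have mh j : measurable_fun setT (fun om => hs t i om 0 j).
  exact: measurableT_comp (mg i (ps i) j) (measurable_funPT (xi i t.+1)).
apply: (vL2_dominated mh (W := fun om => dot (hs t i om) (hs t i om))) => //.
apply: (has_law_integrable law _ (hs_int i)).
by apply: measurable_sum => j; apply: measurable_funM; exact: mg.
Qed.

Let up_meas t i j : measurable_fun setT (fun om => up t i om 0 j).
Proof.
by apply: (sgd_point_measurable eta alpha L_gt0 mg gL) => // *; exact: v_meas.
Qed.

Let gr_L2_of t i : (t < n)%N -> vL2 (up t i) -> vL2 (gr t i).
Proof.
move=> tn Lup.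
have mgr j : measurable_fun setT (fun om => gr t i om 0 j).
  by apply: (grad_measurable L_gt0 mg gL) => // k; exact: up_meas.
have Ldiff : vL2 (fun om => up t i om - ps i).
  by apply: vL2B => //; exact: vL2_cst.
apply: (vL2_dominated mgr (W := fun om =>
    2%:R * (L ^+ 2 * dot (up t i om - ps i) (up t i om - ps i))
    + 2%:R * dot (hs t i om) (hs t i om))).
  apply: integrable_realD; apply: integrable_realZ.
    by apply: integrable_realZ; exact: vL2_dot_integrable.
  by apply: vL2_dot_integrable; exact: hs_L2.
move=> om; apply: (le_trans (dotB_le _ (hs t i om))).
by rewrite lerD2r ler_wpM2l//; exact: gL.
Qed.

(** Second moments are given at [zs] only; the Lipschitz bound carries them from one iterate to the
    next. *)
Let Z_L2 t : (t <= n)%N ->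
  vL2 (fun om => (Z t om).1) /\ forall i, vL2 (fun om => row i (Z t om).2).
Proof.
elim: t => [_|t IH tn].
  by split => [|i]; [|under eq_fun do rewrite row0]; exact: vL2_cst.
have [L1 L2] := IH (ltnW tn).
have Lgr i : vL2 (gr t i) by apply: gr_L2_of => //; exact: vL2_row_mx.
split => [|i].
  apply: vL2B => //; apply: vL2Z; apply: vL2D; last exact: v_L2.
  by apply: vL2Z; apply: vL2_sum => i; exact: vL2_lsubmx (Lgr i).
rewrite /Z/=; under eq_fun do rewrite rowK.
by apply: vL2B => //; apply: vL2Z; exact: vL2_rsubmx (Lgr i).
Qed.

Let up_L2 t i : (t <= n)%N -> vL2 (up t i).
Proof. by move=> tn; have [L1 L2] := Z_L2 tn; exact: vL2_row_mx. Qed.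

Let gr_L2 t i : (t < n)%N -> vL2 (gr t i).
Proof. by move=> tn; apply: gr_L2_of => //; exact: up_L2 (ltnW tn). Qed.

Let xi_other k i s (sn : (s < n)%N) : inl (i, Ordinal sn) != k ->
  measurable_fun setT (xi i s.+1 : other_sources src k -> X).
Proof. by move=> ik; exact: other_source_measurable ik _ srcT. Qed.

Let v_other k s (sn : (s < n)%N) j : inr (Ordinal sn) != k ->
  measurable_fun setT ((fun om => v om s.+1 0 j) : other_sources src k -> R).
Proof.
move=> sk; rewrite /v; under eq_fun do rewrite mxE.
have mz : measurable_fun setT (zeta s.+1 : other_sources src k -> dw.-tuple R).
  exact: other_source_measurable sk _ srcT.
exact: measurableT_comp (tnth_meas j) mz.
Qed.

(* The source indexed by [s] is drawn in round [s.+1], so iterate [t] only depends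
   on the sources of index below [t]. *)
Let late t (k : 'I_N * 'I_n + 'I_n) : bool :=
  match k with inl it => (t <= it.2)%N | inr s => (t <= s)%N end.

Let Z_other t k : (t <= n)%N -> late t k ->
  (forall j, measurable_fun setT
     ((fun om => (Z t om).1 0 j) : other_sources src k -> R)) /\
  (forall i j, measurable_fun setT
     ((fun om => (Z t om).2 i j) : other_sources src k -> R)).
Proof.
move=> tn lk.
apply: (@sgd_measurable _ _ _ _ _ _ g eta alpha L L_gt0 mg gL _
  (other_sources src k) (fun om i t => xi i t om) v t).
- move=> i s st; apply: (xi_other (sn := leq_trans st tn)).
  by apply/eqP => kE; move: lk; rewrite -kE /= leqNgt st.
- move=> s j st; apply: (v_other (sn := leq_trans st tn)).
  by apply/eqP => kE; move: lk; rewrite -kE /= leqNgt st.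
Qed.

Let up_other t k i j : (t <= n)%N -> late t k ->
  measurable_fun setT ((fun om => up t i om 0 j) : other_sources src k -> R).
Proof. by move=> tn lk; have [m1 m2] := Z_other tn lk; exact: user_point_measurable. Qed.

Definition expected_loss i u : R := \int[Pi i]_x f i u x.

(** The iterate depends on sources other than the fresh sample, which is therefore averaged out.
    Integrability holds because the two subgradient inequalities place the gap between <hs, up - ps>
    and <gr, up - ps>. *)
Let loss_gap t i : (t < n)%N ->
  [/\ P.-integrable setT
       (EFin \o (fun om => f i (up t i om) (xi i t.+1 om) - f i (ps i) (xi i t.+1 om))),
     P.-integrable setT
       (EFin \o (fun om => expected_loss i (up t i om) - expected_loss i (ps i))) &
     \int[P]_om (f i (up t i om) (xi i t.+1 om) - f i (ps i) (xi i t.+1 om)) =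
     \int[P]_om (expected_loss i (up t i om) - expected_loss i (ps i))].
Proof.
move=> tn; pose k : 'I_N * 'I_n + 'I_n := inl (i, Ordinal tn).
have law := xi_law i (Ordinal tn).
have mf u : measurable_fun setT (f i u).
  by apply/measurable_EFinP; exact: measurable_int (f_int i u).
pose h om x := f i (up t i om) x - f i (ps i) x.
have mh : measurable_fun setT (fun p : other_sources src k * X => h p.1 p.2).
  apply: measurable_funB; last exact: measurableT_comp.
  apply: (@caratheodory_measurable R _ _ (other_sources src k * X)%type X D (f i)
    (fun p => up t i p.1) snd) => //.
  - by move=> x v_ u vu; exact: (subgradient_cvg L_gt0 (fg i x) (gL i x)).
  - move=> j; have lk : late t k by rewrite /late/=.
    exact: measurableT_comp (up_other i j (ltnW tn) lk) measurable_fst.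
have mhX : measurable_fun setT (fun om => h om (xi i t.+1 om)).
  apply: measurable_funB; last exact: measurableT_comp.
  apply: (caratheodory_measurable (phi := f i) (u := up t i)) => //.
  by move=> x v_ u vu; exact: (subgradient_cvg L_gt0 (fg i x) (gL i x)).
have Ldiff : vL2 (fun om => up t i om - ps i).
  by apply: vL2B; [exact: up_L2 (ltnW tn)|exact: vL2_cst].
have ih : P.-integrable setT (EFin \o (fun om => h om (xi i t.+1 om))).
  apply: (integrable_real_le (W := fun om =>
      (dot (gr t i om) (gr t i om) + dot (hs t i om) (hs t i om))
      + dot (up t i om - ps i) (up t i om - ps i))) => //.
    apply: integrable_realD; last exact: vL2_dot_integrable.
    by apply: integrable_realD; apply: vL2_dot_integrable;
      [exact: gr_L2|exact: gr_L2|exact: hs_L2|exact: hs_L2].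
  move=> om; have H1 := fg i (xi i t.+1 om) (up t i om) (ps i).
  have H2 := fg i (xi i t.+1 om) (ps i) (up t i om).
  have H3 := dot_norm_le (hs t i om) (up t i om - ps i).
  have H4 := dot_norm_le (gr t i om) (up t i om - ps i).
  have e : ps i - up t i om = - (up t i om - ps i) by rewrite opprB.
  rewrite e dotNr in H1.
  have := dot_ge0 (gr t i om); have := dot_ge0 (hs t i om).
  move: H1 H2 H3 H4; rewrite /h -/(gr t i om) -/(hs t i om) !ler_norml.
  move=> H1 H2 /andP[H3 H3'] /andP[H4 H4'] *; apply/andP; split; lra.
have iPi u : (distribution P (xi i t.+1)).-integrable setT (EFin \o f i u).
  exact: has_law_distribution_integrable law (f_int i u).
have [iH EH] := @source_integral _ _ _ _ _ P _ src indep src_meas srcI k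
  (xi i t.+1) erefl h (fun om => expected_loss i (up t i om) - expected_loss i (ps i))
  mh ih (fun om => integrableB measurableT (iPi (up t i om)) (iPi (ps i)))
  (fun om => etrans (RintegralB measurableT (iPi (up t i om)) (iPi (ps i)))
    (congr2 (fun a b => a - b) (has_law_distribution_integral _ law)
       (has_law_distribution_integral _ law))).
by split.
Qed.

(** The mean of the sample gradients, identified later with the gradient of the user risk. *)
Definition mean_grad_w i : 'rV[R]_dw :=
  \row_j \int[Pi i]_x lsubmx (g i (ps i) x) 0 j.

Definition grad_w_var i : R :=
  \int[Pi i]_x dot (lsubmx (g i (ps i) x) - mean_grad_w i)
                   (lsubmx (g i (ps i) x) - mean_grad_w i).

Definition grad_th_var i : R :=
  \int[Pi i]_x dot (rsubmx (g i (ps i) x)) (rsubmx (g i (ps i) x)).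

Let hs_L2Pi i : vec_square_integrable (Pi i) (g i (ps i)).
Proof. exact: (vL2_dominated (mg i (ps i)) (hs_int i)). Qed.

Let dev i x := lsubmx (g i (ps i) x) - mean_grad_w i.

Let dev_L2Pi i : vec_square_integrable (Pi i) (dev i).
Proof. by apply: vL2B; [exact: vL2_lsubmx|exact: vL2_cst]. Qed.

Let dev_meas i j : measurable_fun setT (fun x => dev i x 0 j).
Proof. exact: L2_measurable (dev_L2Pi i j). Qed.

Let dev_mean0 i j : \int[Pi i]_x dev i x 0 j = 0.
Proof.
have il : (Pi i).-integrable setT (EFin \o (fun x => lsubmx (g i (ps i) x) 0 j)).
  exact: L2_integrable (vL2_lsubmx (hs_L2Pi i) j).
rewrite /dev; under eq_Rintegral do rewrite mxE [X in _ + X]mxE.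
rewrite RintegralB//; last exact: integrable_real_cst.
by rewrite Rintegral_prob_cst mxE subrr.
Qed.

Let dev_L2 t i : (t < n)%N -> vL2 (fun om => dev i (xi i t.+1 om)).
Proof.
by move=> tn; apply: vL2B; [exact: vL2_lsubmx (hs_L2 i tn)|exact: vL2_cst].
Qed.

(** Off the diagonal, user [k] provides the fresh source, and the deviation of user [i] is a
    function of the other sources. *)
Let dev_cross t i k : (t < n)%N ->
  \int[P]_om dot (dev i (xi i t.+1 om)) (dev k (xi k t.+1 om)) =
  if i == k then grad_w_var i else 0.
Proof.
move=> tn; have law l := xi_law l (Ordinal tn).
case: eqVneq => [<-|ik].
  rewrite (has_law_integral (law i) (W := fun x => dot (dev i x) (dev i x)))//.
    by apply: measurable_sum => j; exact: measurable_funM.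
  exact: vL2_dot_integrable.
rewrite Rintegral_sum; last first.
  by move=> j _; exact: L2M_integrable (dev_L2 i tn j) (dev_L2 k tn j).
apply: big1 => j _.
pose kk : 'I_N * 'I_n + 'I_n := inl (k, Ordinal tn).
have mY : measurable_fun setT
    ((fun om => dev i (xi i t.+1 om) 0 j) : other_sources src kk -> R).
  have ikk : (inl (i, Ordinal tn) : 'I_N * 'I_n + 'I_n) != kk.
    by apply: contra_neq ik => -[].
  exact: measurableT_comp (dev_meas i j) (xi_other ikk).
apply: (@source_integral_mul0 _ _ _ _ _ P _ src indep src_meas srcI kk
  (xi k t.+1) erefl _ (fun x => dev k x 0 j) mY) => //.
- exact: dev_L2.
- exact: (dev_L2 k tn j).
- rewrite (has_law_integral (law k) (W := fun x => dev k x 0 j))//.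
  exact: L2_integrable (dev_L2Pi k j).
Qed.

Hypothesis stationary : \sum_i mean_grad_w i = 0.

(** The mean gradients cancel in the sum over users, not one by one. The average gradient at [zs] is
    thus an average of centered terms, and of its N^2 products only the N diagonal ones remain. *)
Let avg_noise t : (t < n)%N ->
  \int[P]_om dot (avg_lsub (hs t ^~ om)) (avg_lsub (hs t ^~ om)) =
  N%:R^-1 ^+ 2 * \sum_i grad_w_var i.
Proof.
move=> tn.
have avgE om : dot (avg_lsub (hs t ^~ om)) (avg_lsub (hs t ^~ om)) =
    N%:R^-1 ^+ 2 * \sum_i \sum_k dot (dev i (xi i t.+1 om)) (dev k (xi k t.+1 om)).
  have -> : avg_lsub (hs t ^~ om) = N%:R^-1 *: \sum_i dev i (xi i t.+1 om).
    by rewrite /avg_lsub /dev sumrB stationary subr0.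
  rewrite dotZl dotZr mulrA -expr2 dot_suml; congr (_ * _).
  apply: eq_bigr => i _; rewrite dotC dot_suml; apply: eq_bigr => k _.
  exact: dotC.
have idot i k : P.-integrable setT
    (EFin \o (fun om => dot (dev i (xi i t.+1 om)) (dev k (xi k t.+1 om)))).
  by apply: vL2_dot_integrable; exact: dev_L2.
under eq_Rintegral do rewrite avgE.
rewrite RintegralZl//; last first.
  by apply: integrable_real_sum => i _; exact: integrable_real_sum.
rewrite Rintegral_sum => [|i _]; last exact: integrable_real_sum.
congr (_ * _); apply: eq_bigr => i _; rewrite Rintegral_sum//.
under eq_bigr do rewrite dev_cross//.
by rewrite -big_mkcond/= (big_pred1 i)// => k; rewrite eq_sym.
Qed.

Hypotheses (eta_le : 4%:R * L * Num.max alpha N%:R^-1 * eta <= 1)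
  (zs1_alpha0 : alpha = 0 -> zs.1 = 0).

Let Y t om := (2%:R * alpha * eta ^+ 2) *: avg_lsub (gr t ^~ om)
  - (2%:R * eta) *: ((Z t om).1 - zs.1).

Let Y_L2 t : (t < n)%N -> vL2 (Y t).
Proof.
move=> tn; apply: vL2B; apply: vL2Z.
  by apply: vL2Z; apply: vL2_sum => i; apply: vL2_lsubmx; exact: gr_L2.
by apply: vL2B; [have [] := Z_L2 (ltnW tn)|exact: vL2_cst].
Qed.

(** [Y t] contains the samples of the very round whose noise it multiplies. Independence from
    earlier rounds would not suffice; the noise is also independent of the samples of its own
    round. *)
Let Y_other t (tn : (t < n)%N) j : measurable_fun setT
  ((fun om => Y t om 0 j) : other_sources src (inr (Ordinal tn)) -> R).
Proof.
have lk : late t (inr (Ordinal tn)) by rewrite /late/=.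
have [mZ _] := Z_other (ltnW tn) lk.
have mgr i l : measurable_fun setT
    ((fun om => gr t i om 0 l) : other_sources src (inr (Ordinal tn)) -> R).
  apply: (@grad_measurable R dX X N dw dth g L L_gt0 mg gL _
    (other_sources src (inr (Ordinal tn))) i (up t i) (xi i t.+1)).
    by move=> l'; exact: up_other (ltnW tn) lk.
  exact: (xi_other (sn := tn)).
rewrite /Y; under eq_fun do rewrite !mxE summxE.
under eq_fun do under eq_bigr do rewrite mxE.
apply: measurable_funB; last first.
  by apply: measurable_funM => //; apply: measurable_funB => //; exact: mZ.
apply: measurable_funM => //; apply: measurable_funM => //.
by apply: measurable_sum => i; exact: mgr.
Qed.

Let Y_mean0 t : (t < n)%N -> \int[P]_om dot (Y t om) (v om t.+1) = 0.
Proof.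
move=> tn; rewrite Rintegral_sum; last first.
  by move=> j _; exact: L2M_integrable (Y_L2 tn j) (v_L2 tn j).
apply: big1 => j _; have [Lv _ v0] := noise_moments j tn.
have vE om : v om t.+1 0 j = tnth (zeta t.+1 om) j by rewrite /v mxE.
have Lz : square_integrable P ((fun u => tnth u j) \o zeta t.+1).
  by rewrite (_ : _ \o _ = (fun om => v om t.+1 0 j))//; apply/funext => om; rewrite vE.
have z0 : \int[P]_om tnth (zeta t.+1 om) j = 0.
  by rewrite -v0; apply: eq_Rintegral => om _; rewrite vE.
transitivity (\int[P]_om (Y t om 0 j * tnth (zeta t.+1 om) j)).
  by apply: eq_Rintegral => om _; rewrite vE.
exact: (@source_integral_mul0 _ _ _ _ _ P _ src indep src_meas srcI
  (inr (Ordinal tn)) (zeta t.+1) erefl (fun om => Y t om 0 j) (fun u => tnth u j)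
  (@Y_other t tn j) (tnth_meas j) (Y_L2 tn j) Lz z0).
Qed.

Let noise t om : R :=
  2%:R * alpha * eta ^+ 2 * dot (avg_lsub (hs t ^~ om)) (avg_lsub (hs t ^~ om))
  + 2%:R * (eta / N%:R) ^+ 2 * \sum_i dot (rsubmx (hs t i om)) (rsubmx (hs t i om))
  + alpha * eta ^+ 2 * dot (v om t.+1) (v om t.+1)
  + dot (Y t om) (v om t.+1).

(** All variances end up with the same factor 2 eta^2: for the gradients it comes from separating g
    - h from h, for the server noise from the bound 2 s^2 on the second moment of a coordinate. *)
Let noise_mean t : (t < n)%N ->
  P.-integrable setT (EFin \o noise t) /\
  \int[P]_om noise t om <= 2%:R * eta ^+ 2 *
    ((alpha * (N%:R^-1 * \sum_i grad_w_var i) + N%:R^-1 * \sum_i grad_th_var i) / N%:R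
     + alpha * dw%:R * sigma_zeta ^+ 2).
Proof.
move=> tn.
have Lavg : vL2 (fun om => avg_lsub (hs t ^~ om)).
  by apply: vL2Z; apply: vL2_sum => i; apply: vL2_lsubmx; exact: hs_L2.
have Lr i : vL2 (fun om => rsubmx (hs t i om)).
  by apply: vL2_rsubmx; exact: hs_L2.
have i1 := integrable_realZ (2%:R * alpha * eta ^+ 2) (vL2_dot_integrable Lavg Lavg).
have ir i := vL2_dot_integrable (Lr i) (Lr i).
have ir' : P.-integrable setT
    (EFin \o (fun om => \sum_i dot (rsubmx (hs t i om)) (rsubmx (hs t i om)))).
  by apply: integrable_real_sum => i _; exact: ir.
have i2 := integrable_realZ (2%:R * (eta / N%:R) ^+ 2) ir'.
have iv := vL2_dot_integrable (v_L2 tn) (v_L2 tn).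
have i3 := integrable_realZ (alpha * eta ^+ 2) iv.
have i4 := vL2_dot_integrable (Y_L2 tn) (v_L2 tn).
have i12 := integrable_realD i1 i2.
have i123 := integrable_realD i12 i3.
split; first exact: integrable_realD.
rewrite RintegralD// RintegralD// RintegralD// Y_mean0// addr0.
rewrite !RintegralZl//; [|exact: vL2_dot_integrable].
rewrite avg_noise// Rintegral_sum//.
have -> : \sum_i \int[P]_om dot (rsubmx (hs t i om)) (rsubmx (hs t i om)) =
    \sum_i grad_th_var i.
  apply: eq_bigr => i _.
  have Lpi := vL2_rsubmx (hs_L2Pi i).
  rewrite (has_law_integral (xi_law i (Ordinal tn))
    (W := fun x => dot (rsubmx (g i (ps i) x)) (rsubmx (g i (ps i) x))))//.
    by apply: measurable_sum => j; apply: measurable_funM;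
      exact: L2_measurable (Lpi j).
  exact: vL2_dot_integrable.
have Hv : \int[P]_om dot (v om t.+1) (v om t.+1) <=
    dw%:R * (2%:R * sigma_zeta ^+ 2).
  rewrite Rintegral_sum; last first.
    by move=> j _; exact: L2M_integrable (v_L2 tn j) (v_L2 tn j).
  rewrite -[X in X%:R * _](card_ord dw) mulr_natl -sumr_const.
  by apply: ler_sum => j _; have [] := noise_moments j tn.
have Hv' := ler_wpM2l (mulr_ge0 alpha_ge0 (sqr_ge0 eta)) Hv.
rewrite -(lerD2l (2%:R * alpha * eta ^+ 2 * (N%:R^-1 ^+ 2 * \sum_i grad_w_var i)
  + 2%:R * (eta / N%:R) ^+ 2 * \sum_i grad_th_var i)) in Hv'.
apply: (le_trans Hv'); rewrite le_eqVlt; apply/orP; left; apply/eqP.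
ring.
Qed.

Lemma expected_descent :
  (forall t, (t < n)%N -> P.-integrable setT (EFin \o (fun om =>
     N%:R^-1 * \sum_i (expected_loss i (up t i om) - expected_loss i (ps i))))) /\
  2%:R * eta * \sum_(t < n) \int[P]_om
     (N%:R^-1 * \sum_i (expected_loss i (up t i om) - expected_loss i (ps i)))
  <= nsq alpha zs + n%:R * (2%:R * eta ^+ 2 *
    ((alpha * (N%:R^-1 * \sum_i grad_w_var i) + N%:R^-1 * \sum_i grad_th_var i) / N%:R
     + alpha * dw%:R * sigma_zeta ^+ 2)).
Proof.
split.
  move=> t tn; apply: integrable_realZ; apply: integrable_real_sum => i _.
  by have [] := loss_gap i tn.
pose a t om i := f i (up t i om) (xi i t.+1 om) - f i (ps i) (xi i t.+1 om).
have ia t i : (t < n)%N -> P.-integrable setT (EFin \o (a t ^~ i)).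
  by move=> tn; have [] := loss_gap i tn.
have isum t : (t < n)%N -> P.-integrable setT (EFin \o (fun om => \sum_i a t om i)).
  by move=> tn; apply: integrable_real_sum => i _; exact: ia.
have iA t : (t < n)%N ->
    P.-integrable setT (EFin \o (fun om => N%:R^-1 * \sum_i a t om i)).
  by move=> tn; apply: integrable_realZ; exact: isum.
have step_om t om : (t < n)%N -> nsq alpha (Z t.+1 om - zs)
    + 2%:R * eta * (N%:R^-1 * \sum_i a t om i) <= nsq alpha (Z t om - zs) + noise t om.
  move=> tn; rewrite /noise !addrA /Y; apply: (step_le (L := L)) => //.
    by move=> a0; rewrite zs1_alpha0// /Z sgd_alpha0.
  move=> i; have := cocoercive L_gt0 (fg i (xi i t.+1 om)) (gL i (xi i t.+1 om))
    (up t i om) (ps i).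
  have -> : ps i - up t i om = - (up t i om - ps i) by rewrite opprB.
  rewrite dotNr -/(gr t i om) -/(hs t i om).
  have -> : dot (hs t i om - gr t i om) (hs t i om - gr t i om) =
      dot (gr t i om - hs t i om) (gr t i om - hs t i om).
    by rewrite -[hs t i om - _]opprB dotNl dotNr opprK.
  rewrite /a -/(ps i) -/(up t i om); lra.
(* The telescoping is pathwise and the last distance is dropped before integration, so the squared
   distances to the iterates are never integrated. *)
have tele m om : (m <= n)%N -> nsq alpha (Z m om - zs)
    + 2%:R * eta * \sum_(t < m) (N%:R^-1 * \sum_i a t om i)
    <= nsq alpha zs + \sum_(t < m) noise t om.
  elim: m => [_|m IH mn].
    rewrite !big_ord0 mulr0 !addr0 /nsq.
    have -> : (Z 0 om - zs).1 = - zs.1 by rewrite -[LHS]/(0 - zs.1) sub0r.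
    have -> : (Z 0 om - zs).2 = - zs.2 by rewrite -[LHS]/(0 - zs.2) sub0r.
    rewrite dotNl dotNr opprK lerD2l; apply: ler_sum => i _.
    by rewrite linearN dotNl dotNr opprK.
  rewrite !big_ord_recr/= mulrDr.
  have := IH (ltnW mn); have := step_om m om mn; lra.
have {}tele om : 2%:R * eta * \sum_(t < n) (N%:R^-1 * \sum_i a t om i)
    <= nsq alpha zs + \sum_(t < n) noise t om.
  by apply: le_trans (tele n om (leqnn n)); rewrite lerDr nsq_ge0.
have iSa : P.-integrable setT
    (EFin \o (fun om => \sum_(t < n) (N%:R^-1 * \sum_i a t om i))).
  by apply: integrable_real_sum => t _; exact: iA.
have iSn : P.-integrable setT (EFin \o (fun om => \sum_(t < n) noise t om)).
  by apply: integrable_real_sum => t _; have [] := noise_mean (ltn_ord t).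
have : \int[P]_om (2%:R * eta * \sum_(t < n) (N%:R^-1 * \sum_i a t om i)) <=
    \int[P]_om (nsq alpha zs + \sum_(t < n) noise t om).
  apply: le_Rintegral => //; first exact: integrable_realZ.
  by apply: integrable_realD => //; exact: integrable_real_cst.
rewrite RintegralZl// Rintegral_sum => [|t _]; last exact: iA.
rewrite RintegralD//; last exact: integrable_real_cst.
rewrite Rintegral_prob_cst Rintegral_sum => [|t _]; last first.
  by have [] := noise_mean (ltn_ord t).
have -> : \sum_(t < n) \int[P]_om (N%:R^-1 * \sum_i a t om i) =
    \sum_(t < n) \int[P]_om (N%:R^-1 *
       \sum_i (expected_loss i (up t i om) - expected_loss i (ps i))).
  apply: eq_bigr => t _; rewrite !RintegralZl//; last 2 first.
  - by apply: integrable_real_sum => i _; have [] := loss_gap i (ltn_ord t).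
  - exact: isum.
  congr (_ * _); rewrite !Rintegral_sum//.
  - by apply: eq_bigr => i _; have [] := loss_gap i (ltn_ord t).
  - by move=> i _; have [] := loss_gap i (ltn_ord t).
  - by move=> i _; exact: ia.
move/le_trans; apply; rewrite lerD2l -[X in X%:R * _](card_ord n) mulr_natl.
by rewrite -sumr_const; apply: ler_sum => t _; have [] := noise_mean (ltn_ord t).
Qed.

End Core.

(** * The expected loss *)

Section ExpectedLoss.
Context {R : realType} {dX} {X : measurableType dX} {D : nat}.
Variables (Q : probability X R).
Variables (f : 'rV[R]_D -> X -> R) (g : 'rV[R]_D -> X -> 'rV[R]_D) (L : R).
Hypotheses (L_gt0 : 0 < L) (f_int : forall v, Q.-integrable setT (EFin \o f v))
  (fg : forall x, subgradient (f ^~ x) (g ^~ x))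
  (gL : forall x, lipschitz_l2 (g ^~ x) L).

Let F v : R := \int[Q]_x f v x.

Let mf v : measurable_fun setT (f v).
Proof. by apply/measurable_EFinP; exact: measurable_int (f_int v). Qed.

Let quad v e h x : `|f (h *: e + v) x - f v x - h * dot (g v x) e|
  <= L * dot e e * h ^+ 2.
Proof.
have := fg x v (h *: e + v); have := subgradient_upper L_gt0 (fg x) (gL x) v (h *: e + v).
have -> : h *: e + v - v = h *: e by rewrite addrK.
rewrite !(dotZl, dotZr) => H1 H2.
by rewrite ler_norml; apply/andP; split; nra.
Qed.

(** Measurability in the sample is inherited from the losses: the component along [e] is the limit
    of difference quotients, whose error is of order 1/(n+1) by [quad]. *)
Lemma subgradient_measurable v e : measurable_fun setT (fun x => dot (g v x) e).
Proof.
apply: (@measurable_fun_cvg _ _ _ _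
    (fun n x => n.+1%:R * (f (n.+1%:R^-1 *: e + v) x - f v x))).
  by move=> n; apply: measurable_funM => //; exact: measurable_funB.
move=> x _; apply/cvgrPdist_le => r r0.
have c0 : 0 <= L * dot e e by rewrite mulr_ge0 ?dot_ge0// ltW.
have r1 : 0 < r / (L * dot e e + 1) by rewrite divr_gt0// ltr_wpDl.
have := @cvg_harmonic R => /cvgrPdist_le/(_ _ r1); apply: filterS => n.
rewrite sub0r normrN /harmonic/= ger0_norm ?invr_ge0// => Hn.
set h : R := n.+1%:R^-1; have h0 : 0 < h by rewrite invr_gt0.
have -> : dot (g v x) e - n.+1%:R * (f (h *: e + v) x - f v x) =
    - (h^-1 * (f (h *: e + v) x - f v x - h * dot (g v x) e)).
  by rewrite [in RHS]mulrBr mulKf ?gt_eqF// opprB /h invrK.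
rewrite normrN normrM gtr0_norm ?invr_gt0// ler_pdivrMl//.
apply: (le_trans (quad v e h x)).
rewrite expr2 mulrA mulrC ler_wpM2l ?(ltW h0)//.
apply: (@le_trans _ _ (L * dot e e * (r / (L * dot e e + 1)))).
  by rewrite ler_wpM2l.
rewrite mulrA ler_pdivrMr ?ltr_wpDl// mulrC ler_wpM2l ?(ltW r0)//; lra.
Qed.

(** The component along [e] lies between f v - f (v - e) and f (v + e) - f v. *)
Lemma subgradient_integrable v e :
  Q.-integrable setT (EFin \o (fun x => dot (g v x) e)).
Proof.
have i2 : Q.-integrable setT
    (EFin \o (fun x => `|f (v + e) x - f v x| + `|f v x - f (v - e) x|)).
  by apply: integrable_realD; apply: integrable_norm;
    exact: integrable_realB.
apply: integrable_real_le i2 _; first exact: subgradient_measurable.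
move=> x; have := fg x v (v + e); have := fg x v (v - e).
have -> : v + e - v = e by rewrite addrAC subrr add0r.
have -> : v - e - v = - e by rewrite addrAC subrr add0r.
rewrite dotNr => H1 H2.
have := ler_norm (f (v + e) x - f v x); have := ler_norm (- (f v x - f (v - e) x)).
rewrite normrN; have := normr_ge0 (f (v + e) x - f v x); have := normr_ge0 (f v x - f (v - e) x).
by rewrite ler_norml => *; apply/andP; split; lra.
Qed.

(** The pointwise remainder bound is uniform in the sample, so it integrates as it stands; no limit
    has to be exchanged with the integral. *)
Lemma expected_loss_quadratic v e h :
  `|F (h *: e + v) - F v - h * \int[Q]_x dot (g v x) e| <= L * dot e e * h ^+ 2.
Proof.
have ig := subgradient_integrable v e.
rewrite /F -RintegralB// -RintegralZl// -RintegralB//; last 2 first.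
- exact: integrable_realB.
- exact: integrable_realZ.
have i : Q.-integrable setT (EFin \o
    (fun x => f (h *: e + v) x - f v x - h * dot (g v x) e)).
  by apply: integrable_realB => //; [exact: integrable_realB|exact: integrable_realZ].
apply: (le_trans (le_normr_Rintegral measurableT i)).
rewrite -[leRHS](Rintegral_prob_cst Q); apply: le_Rintegral => //.
- exact: (integrable_norm i).
- exact: integrable_real_cst.
Qed.

(** The subgradient inequality is taken at the mean point, where the linear terms sum to 0. *)
Lemma expected_loss_jensen n (v : 'I_n -> 'rV[R]_D) : (0 < n)%N ->
  F (n%:R^-1 *: \sum_t v t) <= n%:R^-1 * \sum_t F (v t).
Proof.
move=> n0; set m := _ *: _.
have n0' : (n%:R : R) != 0 by rewrite pnatr_eq0 -lt0n.
rewrite /F -Rintegral_sum// -RintegralZl//; last exact: integrable_real_sum.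
apply: le_Rintegral => //.
  by apply: integrable_realZ; exact: integrable_real_sum.
move=> x _; have H : \sum_t (f m x + dot (g m x) (v t - m)) <= \sum_t f (v t) x.
  by apply: ler_sum => t _; exact: fg.
rewrite -(ler_pM2l (_ : 0 < n%:R)) ?ltr0n ?mulVKf//.
apply: le_trans H; rewrite big_split/= sumr_const card_ord -[f m x *+ n]mulr_natl lerDl.
under eq_bigr do rewrite dotC.
rewrite -dot_suml sumrB sumr_const card_ord.
by rewrite -scaler_nat /m scalerA divff// scale1r subrr dot0l.
Qed.

End ExpectedLoss.

(** * Estimates for the chosen step size *)

Section Numeric.
Context {R : realType}.

(** [rn] stands for sqrt n. One always has eta s^2 <= s nz / rn; the first term equals 2 La nz^2 /
    rn^2 in one branch of the minimum and half of s nz / rn in the other. *)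
Lemma step_size_bound (La nz s eta rn : R) : 0 < La -> 0 <= nz -> 0 <= s ->
  0 < rn -> 0 < eta ->
  (eta = 1 / (4%:R * La) \/ s != 0 /\ eta = nz / (rn * s)) ->
  (s != 0 -> eta <= nz / (rn * s)) ->
  nz ^+ 2 / (2%:R * eta * rn ^+ 2) + eta * s ^+ 2 <=
  4%:R * La * nz ^+ 2 / rn ^+ 2 + 3%:R * (s * nz / rn).
Proof.
move=> La0 nz0 s0 rn0 e0 etaE eta_le.
have snz : 0 <= s * nz / rn by rewrite divr_ge0 ?mulr_ge0// ltW.
have Lnz : 0 <= La * nz ^+ 2 / rn ^+ 2.
  by rewrite divr_ge0 ?mulr_ge0 ?sqr_ge0// ltW.
have es : eta * s ^+ 2 <= s * nz / rn.
  have [->|sn0] := eqVneq s 0; first by rewrite expr0n/= mulr0 !mul0r.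
  have := ler_wpM2r (sqr_ge0 s) (eta_le sn0).
  have -> : nz / (rn * s) * s ^+ 2 = s * nz / rn by field; rewrite sn0 gt_eqF.
  by [].
case: etaE => [eE|[sn0 eE]].
  have -> : nz ^+ 2 / (2%:R * eta * rn ^+ 2) = 2%:R * (La * nz ^+ 2 / rn ^+ 2).
    by rewrite eE; field; rewrite !gt_eqF.
  rewrite -[4%:R * La * _ / _]mulrA -[4%:R * La * _]mulrA.
  rewrite [La * (_ / _)]mulrA; lra.
have nz1 : nz != 0 by apply: contraTneq e0; rewrite eE => ->; rewrite mul0r ltxx.
have -> : nz ^+ 2 / (2%:R * eta * rn ^+ 2) = 2%:R^-1 * (s * nz / rn).
  by rewrite eE; field; rewrite sn0 nz1 gt_eqF.
rewrite -[4%:R * La * _ / _]mulrA -[4%:R * La * _]mulrA.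
rewrite [La * (_ / _)]mulrA; lra.
Qed.

Lemma sqrtrD_le (x y : R) : 0 <= x -> 0 <= y ->
  Num.sqrt (x + y) <= Num.sqrt x + Num.sqrt y.
Proof.
move=> x0 y0; rewrite -(@ler_pXn2r _ 2) ?nnegrE ?addr_ge0 ?sqrtr_ge0//.
rewrite sqr_sqrtr ?addr_ge0// sqrrD !sqr_sqrtr// addrAC lerDl.
by rewrite mulrn_wge0// mulr_ge0 ?sqrtr_ge0.
Qed.

End Numeric.

(** * Almost sure reduction and the main bound *)

Lemma ae_forall_countable {R : realType} {d} {T : measurableType d}
    (mu : {measure set T -> \bar R}) (C : countType) (Q : C -> T -> Prop) :
  (forall c, {ae mu, forall x, Q c x}) -> {ae mu, forall x, forall c, Q c x}.
Proof.
move=> H.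
have : {ae mu, forall x, forall m, forall c : C, unpickle m = Some c -> Q c x}.
  apply: ae_foralln => m; case E : (unpickle m) => [c|].
    by apply: filterS (H c) => x Qx _ [<-].
  by apply: nearW => x c.
by apply: filterS => x Qx c; apply: (Qx (pickle c)); rewrite pickleK.
Qed.

Lemma dot_delta {R : realType} d (u : 'rV[R]_d) j : dot u (delta_mx 0 j) = u 0 j.
Proof.
rewrite /dot (bigD1 j)//= mxE !eqxx mulr1 big1 ?addr0// => k kj.
by rewrite mxE (negbTE kj) andbF mulr0.
Qed.

Section GoodSamples.
Context {R : realType} {dX} {X : measurableType dX} {N dw dth : nat}.
Variables (Pi : 'I_N -> probability X R).
Variables (f : 'I_N -> 'rV[R]_dw -> 'rV[R]_dth -> X -> R) (L G : R).
Hypotheses (L_gt0 : 0 < L) (G_ge0 : 0 <= G).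

Definition sample_loss i x (v : 'rV[R]_(dw + dth)) : R :=
  f i (lsubmx v) (rsubmx v) x.

Definition sample_grad i x : 'rV[R]_(dw + dth) -> 'rV[R]_(dw + dth) :=
  joint_grad (fun w th => f i w th x).

Definition good_sample i x : Prop :=
  [/\ subgradient (sample_loss i x) (sample_grad i x),
      lipschitz_l2 (sample_grad i x) L &
      forall v, dot (lsubmx (sample_grad i x v)) (lsubmx (sample_grad i x v))
        <= G ^+ 2].

(** The null set of the gradient bound depends on the point. One null set serves the countable grid,
    and continuity of the gradient extends the bound from there to all points. *)
Lemma ae_good_sample i :
  {ae Pi i, forall x, jointly_convex (fun w th => f i w th x) /\
     smooth L (fun w th => f i w th x)} ->
  (forall w th, {ae Pi i, forall x, l2norm (sample_grad_w f i w th x) <= G}) ->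
  {ae Pi i, forall x, good_sample i x}.
Proof.
move=> H2 H3.
have : {ae Pi i, forall x, forall c : 'rV[int]_(dw + dth) * nat,
    l2norm (sample_grad_w f i (lsubmx (grid_point c.2 c.1))
              (rsubmx (grid_point c.2 c.1)) x) <= G}.
  by apply: ae_forall_countable => c; exact: H3.
apply: filterS2 H2 => x [cx sx] Gx.
have lip := smooth_lipschitz (ltW L_gt0) sx.
split => //; first by apply: convex_subgradient => //; case: sx.
move=> v.
pose u m := lsubmx (sample_grad i x (grid_point m (grid_floor m v))).
have cu j : u m 0 j @[m --> \oo] --> lsubmx (sample_grad i x v) 0 j.
  rewrite mxE /u; under eq_fun do rewrite mxE.
  by apply: (lipschitz_cvg L_gt0 lip) => k; exact: grid_cvg.
have c2 := cvg_dot cu cu.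
rewrite -(cvg_lim _ c2)//; apply: limr_le; first by apply/cvg_ex; eexists; exact: c2.
apply: nearW => m; rewrite -l2norm_le// /u /sample_grad /joint_grad row_mxKl.
exact: (Gx (grid_floor m v, m)).
Qed.

End GoodSamples.

Section Reduction.
Context {R : realType} {dX} {X : measurableType dX} {N dw dth n : nat}.
Local Notation D := (dw + dth)%N.
Context {dOm} {Om : measurableType dOm} (P : probability Om R).
Variables (Pi : 'I_N -> probability X R)
  (f : 'I_N -> 'rV[R]_dw -> 'rV[R]_dth -> X -> R).
Variables (xi : 'I_N -> nat -> {RV P >-> X}) (zeta : nat -> {RV P >-> dw.-tuple R}).
Variables (alpha sigma_zeta L G : R) (zs : params R dw N dth).
Hypotheses (N_gt0 : (0 < N)%N) (n_gt0 : (0 < n)%N)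
  (f_int : forall i w th, (Pi i).-integrable [set: X] (EFin \o f i w th))
  (alpha_ge0 : 0 <= alpha) (L_gt0 : 0 < L) (G_ge0 : 0 <= G)
  (xi_law : forall i (t : 'I_n), has_law (xi i t.+1) (Pi i))
  (zeta_law : forall t : 'I_n, isotropic_gaussian sigma_zeta (zeta t.+1))
  (indep : mutually_independent P (source_sigma (n := n) xi zeta))
  (zs_min : is_minimizer Pi f zs)
  (zs1_alpha0 : alpha = 0 -> zs.1 = 0)
  (var_th_fin : forall i, (var_th Pi f zs i < +oo)%E).
Variable bad : 'I_N -> set X.
Hypotheses (bad_meas : forall i, measurable (bad i))
  (bad0 : forall i, Pi i (bad i) = 0%E)
  (badP : forall i x, ~ bad i x -> good_sample f L G i x).

Let fr i v x : R := if x \in bad i then 0 else sample_loss f i x v.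
Let gr i v x : 'rV[R]_D := if x \in bad i then 0 else sample_grad f i x v.

Let good_meas i : measurable (~` bad i).
Proof. exact: measurableC. Qed.

Let good_null i : Pi i (~` ~` bad i) = 0%E.
Proof. by rewrite setCK. Qed.

Let frE i v x : ~ bad i x -> fr i v x = f i (lsubmx v) (rsubmx v) x.
Proof. by move=> bx; rewrite /fr memNset. Qed.

Let grE i v x : ~ bad i x -> gr i v x = sample_grad f i x v.
Proof. by move=> bx; rewrite /gr memNset. Qed.

Let fr_int i v : (Pi i).-integrable setT (EFin \o fr i v).
Proof.
have -> : EFin \o fr i v =
    ((EFin \o f i (lsubmx v) (rsubmx v)) \_ (~` bad i)).
  apply/funext => x; rewrite patchE in_setC /fr /=.
  by case: (x \in bad i).
rewrite -integrable_mkcond//.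
exact: (integrableS measurableT (good_meas i) (@subsetT _ _) (f_int i _ _)).
Qed.

Let fr_sub i x : subgradient (fr i ^~ x) (gr i ^~ x).
Proof.
rewrite /fr /gr; have [_ u v|xb] := boolP (x \in bad i).
  by rewrite dot0l addr0.
by move: xb; rewrite notin_setE => /badP[].
Qed.

Let gr_lip i x : lipschitz_l2 (gr i ^~ x) L.
Proof.
rewrite /gr; have [_ u v|xb] := boolP (x \in bad i).
  by rewrite subrr dot0l mulr_ge0 ?sqr_ge0 ?dot_ge0.
by move: xb; rewrite notin_setE => /badP[].
Qed.

Let gr_bound i x v : dot (lsubmx (gr i v x)) (lsubmx (gr i v x)) <= G ^+ 2.
Proof.
rewrite /gr; have [_|xb] := boolP (x \in bad i).
  by rewrite linear0 dot0l sqr_ge0.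
by move: xb; rewrite notin_setE => /badP[].
Qed.

Let gr_meas i v j : measurable_fun setT (fun x => gr i v x 0 j).
Proof.
under eq_fun do rewrite -dot_delta.
exact: (subgradient_measurable L_gt0 (fr_int i) (fr_sub i) (gr_lip i)).
Qed.

Let ae_bad i : {ae Pi i, forall x, ~ bad i x}.
Proof. by exists (bad i); split => // x /contrapT. Qed.

Let user_riskE i w th :
  user_risk Pi f i w th = expected_loss Pi fr i (row_mx w th).
Proof.
rewrite /user_risk unlock; congr fine; apply: ae_eq_integral => //.
- exact: measurable_int (f_int i w th).
- exact: measurable_int (fr_int i (row_mx w th)).
apply: filterS (ae_bad i) => x bx _ /=.
by rewrite frE// row_mxKl row_mxKr.
Qed.

Let riskE z : risk Pi f z = N%:R^-1 * \sum_i expected_loss Pi fr i (user_point z i).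
Proof. by congr (_ * _); apply: eq_bigr => i _; exact: user_riskE. Qed.

Let mgw i (v : 'rV[R]_D) : 'rV[R]_dw :=
  \row_j \int[Pi i]_x lsubmx (gr i v x) 0 j.

Let dirw j : 'rV[R]_D := row_mx (delta_mx 0 j) 0.

Let dot_dirw (v : 'rV[R]_D) j : dot v (dirw j) = lsubmx v 0 j.
Proof. by rewrite dot_submx row_mxKl row_mxKr dot0r addr0 dot_delta. Qed.

Let expected_loss_dirw i (v : 'rV[R]_D) j h :
  `|expected_loss Pi fr i (h *: dirw j + v) - expected_loss Pi fr i v
    - h * mgw i v 0 j| <= L * h ^+ 2.
Proof.
have := expected_loss_quadratic L_gt0 (fr_int i) (fr_sub i) (gr_lip i) v (dirw j) h.
have -> : dot (dirw j) (dirw j) = 1 by rewrite dot_dirw row_mxKl mxE !eqxx.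
have -> : \int[Pi i]_x dot (gr i v x) (dirw j) = mgw i v 0 j.
  by rewrite mxE; apply: eq_Rintegral => x _; exact: dot_dirw.
by rewrite mulr1.
Qed.

Let grad_user_riskE i w th : grad_w (user_risk Pi f i) w th = mgw i (row_mx w th).
Proof.
apply/rowP => j; rewrite mxE; apply: (derive_of_quadratic_bound (C := L)) => h.
rewrite !user_riskE; have := expected_loss_dirw i (row_mx w th) j h.
by rewrite /dirw scale_row_mx add_row_mx scaler0 add0r.
Qed.

(** Moving the shared [w] changes the losses of all users together, so optimality controls only the
    sum of the mean gradients. *)
Let stationary : \sum_i mean_grad_w Pi gr zs i = 0.
Proof.
apply/rowP => j; rewrite summxE [RHS]mxE.
set M := \sum_i _.
have N0 : 0 < (N%:R : R) by rewrite ltr0n.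
have H h : 0 <= h * M + N%:R * (L * h ^+ 2).
  pose z' : params R dw N dth := (h *: delta_mx 0 j + zs.1, zs.2).
  have := zs_min z'; rewrite !riskE ler_pM2l ?invr_gt0// -subr_ge0 -sumrB.
  move/le_trans; apply; rewrite /M mulr_sumr -[X in X%:R * _](card_ord N).
  rewrite mulr_natl -sumr_const -big_split/=; apply: ler_sum => i _.
  have := expected_loss_dirw i (user_point zs i) j h.
  have -> : h *: dirw j + user_point zs i = user_point z' i.
    by rewrite /dirw /user_point scale_row_mx add_row_mx scaler0 add0r.
  by rewrite ler_norml => /andP[_]; rewrite /mgw/mean_grad_w !mxE; lra.
have c0 : 0 < 2%:R * (N%:R * L) by rewrite !mulr_gt0.
(* The minimizer of the quadratic in h; its minimum -M^2/(4NL) is nonnegative only for M = 0. *)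
have := H (- M / (2%:R * (N%:R * L))).
have -> : - M / (2%:R * (N%:R * L)) * M +
    N%:R * (L * (- M / (2%:R * (N%:R * L))) ^+ 2) =
    - (M ^+ 2 / (4%:R * (N%:R * L))).
  by field; rewrite !gt_eqF.
rewrite oppr_ge0 pmulr_lle0 ?invr_gt0 ?mulr_gt0// => M0.
by apply/eqP; rewrite -sqrf_eq0 eq_le M0 sqr_ge0.
Qed.

(** The integrand with the original gradients may be nonmeasurable because of the bad samples, hence
    two inequalities between integrals. *)
Let var_wE i : fine (var_w Pi f zs i) = grad_w_var Pi gr zs i.
Proof.
rewrite /var_w unlock; congr fine.
have mgE : grad_w (user_risk Pi f i) zs.1 (row i zs.2) = mean_grad_w Pi gr zs i.
  exact: grad_user_riskE.
have E x : (~` bad i) x -> l2norm (sample_grad_w f i zs.1 (row i zs.2) x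
    - grad_w (user_risk Pi f i) zs.1 (row i zs.2)) ^+ 2 =
    dot (lsubmx (gr i (user_point zs i) x) - mean_grad_w Pi gr zs i)
        (lsubmx (gr i (user_point zs i) x) - mean_grad_w Pi gr zs i).
  move=> bx; rewrite l2norm_dot mgE grE//.
  by rewrite /sample_grad /joint_grad /user_point !row_mxKl !row_mxKr.
apply/eqP; rewrite eq_le; apply/andP; split;
  apply: (ge0_le_integral_nonmeasurable (good_meas i) (good_null i)) => x;
  rewrite ?lee_fin ?sqr_ge0 ?dot_ge0//.
- by move=> bx; rewrite E.
- by move=> bx; rewrite E.
Qed.

Let var_thE i :
  (Pi i).-integrable setT (EFin \o (fun x =>
    dot (rsubmx (gr i (user_point zs i) x)) (rsubmx (gr i (user_point zs i) x)))) /\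
  fine (var_th Pi f zs i) = grad_th_var Pi gr zs i.
Proof.
have E x : (~` bad i) x -> l2norm (sample_grad_th f i zs.1 (row i zs.2) x) ^+ 2 =
    dot (rsubmx (gr i (user_point zs i) x)) (rsubmx (gr i (user_point zs i) x)).
  move=> bx; rewrite l2norm_dot grE//.
  by rewrite /sample_grad /joint_grad /user_point !row_mxKr !row_mxKl.
have vE : var_th Pi f zs i = (\int[Pi i]_x
    (dot (rsubmx (gr i (user_point zs i) x)) (rsubmx (gr i (user_point zs i) x)))%:E)%E.
  rewrite /var_th unlock.
  apply/eqP; rewrite eq_le; apply/andP; split;
    apply: (ge0_le_integral_nonmeasurable (good_meas i) (good_null i)) => x;
    rewrite ?lee_fin ?sqr_ge0 ?dot_ge0//.
  - by move=> bx; rewrite E.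
  - by move=> bx; rewrite E.
split; last by rewrite vE.
apply/integrableP; split.
  apply/measurable_EFinP; apply: measurable_sum => j.
  by apply: measurable_funM; under eq_fun do rewrite mxE; exact: gr_meas.
have := var_th_fin i; rewrite vE; apply: le_lt_trans.
by under eq_integral do rewrite /= ger0_norm ?dot_ge0//.
Qed.

Let grad_int i : (Pi i).-integrable setT (EFin \o (fun x =>
  dot (gr i (user_point zs i) x) (gr i (user_point zs i) x))).
Proof.
apply: (integrable_real_le (W := fun x => G ^+ 2 +
    dot (rsubmx (gr i (user_point zs i) x)) (rsubmx (gr i (user_point zs i) x)))).
- by apply: measurable_sum => j; apply: measurable_funM; exact: gr_meas.
- apply: integrable_realD; first exact: integrable_real_cst.
  by have [] := var_thE i.
- by move=> x; rewrite ger0_norm ?dot_ge0// dot_submx lerD2r.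
Qed.

Lemma clip_id k (C : R) (u : 'rV[R]_k) : l2norm u <= C -> clip C u = u.
Proof.
move=> uC; rewrite /clip max_l ?invr1 ?scale1r//.
(* For [C = 0] the quotient is 0 by convention, so the maximum is still 1. *)
have [->|C0] := eqVneq C 0; first by rewrite invr0 mulr0.
have C0' : 0 < C by rewrite lt_neqAle eq_sym C0 (le_trans (l2norm_ge0 u)).
by rewrite ler_pdivrMr// mul1r.
Qed.

Let ppsgd_sgd eta x v t : (forall i s, (s < t)%N -> ~ bad i (x i s.+1)) ->
  ppsgd f eta alpha G x v t = sgd gr eta alpha x v t.
Proof.
elim: t => [//|t IH] nb /=.
rewrite IH => [|i s st]; last by apply: nb; exact: ltnW.
set z := sgd _ _ _ _ _ t.
have gw i : sample_grad_w f i z.1 (row i z.2) (x i t.+1) =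
    lsubmx (gr i (user_point z i) (x i t.+1)).
  rewrite grE; last exact: nb.
  by rewrite /sample_grad /joint_grad /user_point !row_mxKl !row_mxKr.
have gt i : sample_grad_th f i z.1 (row i z.2) (x i t.+1) =
    rsubmx (gr i (user_point z i) (x i t.+1)).
  rewrite grE; last exact: nb.
  by rewrite /sample_grad /joint_grad /user_point !row_mxKr !row_mxKl.
rewrite /step /avg_lsub; congr (_, _).
  congr (_ - _ *: (_ *: _ + _)); apply: eq_bigr => i _.
  by rewrite gw clip_id// l2norm_le//; exact: gr_bound.
by apply/matrixP => i j; rewrite [LHS]mxE [RHS]mxE gt.
Qed.

Let nb_ae : {ae P, forall om, forall i s, (s < n)%N -> ~ bad i (xi i s.+1 om)}.
Proof.
have : {ae P, forall om, forall it : 'I_N * 'I_n, ~ bad it.1 (xi it.1 it.2.+1 om)}.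
  apply: ae_forall_countable => -[i t] /=.
  exists (xi i t.+1 @^-1` bad i); split.
  - by rewrite -[X in measurable X]setTI; exact: measurable_funPT.
  - by rewrite -[LHS]/(distribution P (xi i t.+1) (bad i)) xi_law.
  - by move=> om /contrapT.
by apply: filterS => om H i s sn; exact: (H (i, Ordinal sn)).
Qed.

Let gap z : R := risk Pi f z - risk Pi f zs.

Let gapE z : gap z = N%:R^-1 * \sum_i
  (expected_loss Pi fr i (user_point z i) - expected_loss Pi fr i (user_point zs i)).
Proof. by rewrite /gap !riskE -mulrBr -sumrB. Qed.

Let gap_ge0 z : 0 <= gap z.
Proof. by rewrite subr_ge0. Qed.

Let gap_jensen (z : nat -> params R dw N dth) :
  gap (n%:R^-1 *: \sum_(0 <= t < n) z t) <= n%:R^-1 * \sum_(t < n) gap (z t).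
Proof.
have n0 : (n%:R : R) != 0 by rewrite pnatr_eq0 -lt0n.
have -> : n%:R^-1 * \sum_(t < n) gap (z t) =
    n%:R^-1 * (\sum_(t < n) risk Pi f (z t)) - risk Pi f zs.
  by rewrite sumrB mulrBr sumr_const card_ord -[risk Pi f zs *+ n]mulr_natl mulKf.
rewrite lerD2r riskE; under [in leRHS]eq_bigr do rewrite riskE.
rewrite -mulr_sumr mulrCA ler_wpM2l ?invr_ge0// exchange_big/= mulr_sumr.
apply: ler_sum => i _.
have -> : user_point (n%:R^-1 *: \sum_(0 <= t < n) z t) i =
    n%:R^-1 *: \sum_(t < n) user_point (z t) i.
  rewrite big_mkord /user_point.
  have -> : \sum_(t < n) row_mx (z t).1 (row i (z t).2) =
      row_mx (\sum_(t < n) (z t).1) (row i (\sum_(t < n) (z t).2)).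
    elim/big_rec3 : _ => [|t a b c _ ->]; first by rewrite row0 row_mx0.
    by rewrite add_row_mx linearD.
  rewrite scale_row_mx -linearZ.
  have -> : \sum_(t < n) z t = (\sum_(t < n) (z t).1, \sum_(t < n) (z t).2).
    by elim/big_rec3 : _ => // t a b c _ ->.
  by [].
exact: (expected_loss_jensen (fr_int i) (fr_sub i)).
Qed.

Lemma expected_gap_le eta : 0 <= eta ->
  4%:R * L * Num.max alpha N%:R^-1 * eta <= 1 ->
  (eta = 0 -> nsq alpha zs = 0) ->
  ('E_P[(fun om => risk Pi f (ppsgd_avg f eta alpha G (fun i t => xi i t om)
      (fun t => row_of_tuple (zeta t om)) n) - risk Pi f zs)%R]
   <= (nsq alpha zs / (2%:R * eta * n%:R) + eta * sigma_tot Pi f alpha sigma_zeta zs ^+ 2)%:E)%E.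
Proof.
move=> eta_ge0 eta_le eta0.
have n0 : 0 < (n%:R : R) by rewrite ltr0n.
have N0 : 0 < (N%:R : R) by rewrite ltr0n.
pose Z t om := sgd gr eta alpha (fun i t => xi i t om)
  (fun t => row_of_tuple (zeta t om)) t.
have [int_gap sum_gap] := expected_descent N_gt0 alpha_ge0 eta_ge0 L_gt0 xi_law
  zeta_law indep fr_int gr_meas fr_sub gr_lip grad_int stationary eta_le zs1_alpha0.
have igap t : (t < n)%N -> P.-integrable setT (EFin \o (fun om => gap (Z t om))).
  by move=> tn; under eq_fun do rewrite gapE; exact: int_gap.
have iPhi : P.-integrable setT
    (EFin \o (fun om => n%:R^-1 * \sum_(t < n) gap (Z t om))).
  by apply: integrable_realZ; apply: integrable_real_sum => t _; exact: igap.
have [B [mB B0 HB]] := nb_ae.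
rewrite unlock.
(* Outside the null event [B] the original averaged iterate is the modified one, and Jensen applies.
   The right side is integrable whether or not the left side is measurable. *)
apply: (@le_trans _ _ (\int[P]_om (n%:R^-1 * \sum_(t < n) gap (Z t om))%:E)%E).
  apply: (@ge0_le_integral_nonmeasurable _ _ _ P (~` B)).
  - exact: measurableC.
  - by rewrite setCK.
  - by move=> om; rewrite lee_fin; exact: gap_ge0.
  - move=> om; rewrite lee_fin mulr_ge0 ?invr_ge0 ?(ltW n0)//.
    by apply: sumr_ge0 => t _; exact: gap_ge0.
  move=> om /(contra_notP (@HB om)) /= nb; rewrite lee_fin.
  rewrite -[leLHS]/(gap _).
  have -> : ppsgd_avg f eta alpha G (fun i t => xi i t om)
      (fun t => row_of_tuple (zeta t om)) n =
      n%:R^-1 *: \sum_(0 <= t < n) Z t om.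
    congr (_ *: _); apply: eq_big_nat => t /andP[_ tn].
    apply: ppsgd_sgd => i s st; apply: nb; exact: ltn_trans st tn.
  exact: (gap_jensen (Z ^~ om)).
have fineE : (\int[P]_om (n%:R^-1 * \sum_(t < n) gap (Z t om))%:E)%E =
    (n%:R^-1 * \sum_(t < n) \int[P]_om gap (Z t om))%:E.
  rewrite -Rintegral_sum => [|t _]; last exact: igap.
  rewrite -RintegralZl//; last first.
    by apply: integrable_real_sum => t _; exact: igap.
  by rewrite /Rintegral fineK// integrable_fin_num.
rewrite fineE lee_fin.
have vw0 i : 0 <= grad_w_var Pi gr zs i.
  by apply: Rintegral_ge0 => x _; exact: dot_ge0.
have vt0 i : 0 <= grad_th_var Pi gr zs i.
  by apply: Rintegral_ge0 => x _; exact: dot_ge0.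
pose S := (alpha * (N%:R^-1 * \sum_i grad_w_var Pi gr zs i)
    + N%:R^-1 * \sum_i grad_th_var Pi gr zs i) / N%:R
  + alpha * dw%:R * sigma_zeta ^+ 2.
have S0 : 0 <= S.
  have avg0 (c : 'I_N -> R) : (forall i, 0 <= c i) -> 0 <= N%:R^-1 * \sum_i c i.
    by move=> c0; rewrite mulr_ge0 ?invr_ge0 ?(ltW N0)// sumr_ge0.
  have a1 := avg0 _ vw0; have a2 := avg0 _ vt0.
  rewrite /S addr_ge0// mulr_ge0 ?sqr_ge0 ?invr_ge0 ?(ltW N0)//.
    by rewrite addr_ge0// mulr_ge0.
  by rewrite mulr_ge0.
have -> : sigma_tot Pi f alpha sigma_zeta zs ^+ 2 = S.
  rewrite /sigma_tot.
  have -> : avg_var_w Pi f zs = N%:R^-1 * \sum_i grad_w_var Pi gr zs i.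
    by congr (_ * _); apply: eq_bigr => i _; exact: var_wE.
  have -> : avg_var_th Pi f zs = N%:R^-1 * \sum_i grad_th_var Pi gr zs i.
    by congr (_ * _); apply: eq_bigr => i _; have [] := var_thE i.
  by rewrite sqr_sqrtr.
(* The step size vanishes only if [zs] has norm 0. The iterates then stay at 0 = [zs], and the bound
   reads 0 because division by 0 gives 0. *)
have [e0|e0] := eqVneq eta 0.
  rewrite e0 mul0r addr0 mulr0 mul0r invr0 mulr0.
  have nsq0 := eta0 e0.
  have zs1 : zs.1 = 0.
    have [/zs1_alpha0//|a0] := eqVneq alpha 0.
    have a0' : 0 < alpha by rewrite lt_neqAle eq_sym a0.
    apply: dot_eq0; apply/eqP; rewrite eq_le dot_ge0 andbT.
    have th0 : 0 <= \sum_i dot (row i zs.2) (row i zs.2).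
      by apply: sumr_ge0 => i _; exact: dot_ge0.
    rewrite -(pmulr_rle0 _ (_ : 0 < alpha^-1)) ?invr_gt0//.
    by rewrite -nsq0 /nsq lerDl.
  have zs2 i : row i zs.2 = 0.
    apply: dot_eq0; apply/eqP; rewrite eq_le dot_ge0 andbT.
    rewrite -nsq0 /nsq zs1 dot0l mulr0 add0r (bigD1 i)//= lerDl.
    by apply: sumr_ge0 => k _; exact: dot_ge0.
  have Z0 om t : Z t om = (0, 0).
    rewrite /Z; elim: t => //= t ->; rewrite /step e0 mulr0 scale0r subr0.
    by congr (_, _); apply/matrixP => i j; rewrite !mxE mul0r mul0r subr0.
  have gap0 om t : gap (Z t om) = 0.
    rewrite gapE big1 ?mulr0// => i _; rewrite Z0 /user_point /= zs1 zs2 row0.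
    exact: subrr.
  rewrite big1 ?mulr0// => t _; under eq_Rintegral do rewrite gap0.
  exact: Rintegral_prob_cst.
have e0' : 0 < eta by rewrite lt_neqAle eq_sym e0.
have c0 : 0 < 2%:R * eta * n%:R by rewrite !mulr_gt0.
rewrite -(ler_pM2l c0).
have -> : 2%:R * eta * n%:R * (n%:R^-1 * \sum_(t < n) \int[P]_om gap (Z t om)) =
    2%:R * eta * \sum_(t < n) \int[P]_om (N%:R^-1 * \sum_i
      (expected_loss Pi fr i (user_point (Z t om) i)
       - expected_loss Pi fr i (user_point zs i))).
  rewrite mulrA mulfK ?gt_eqF//; congr (_ * _); apply: eq_bigr => t _.
  by apply: eq_Rintegral => om _; exact: gapE.
apply: le_trans sum_gap _; rewrite -/S le_eqVlt; apply/orP; left; apply/eqP.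
by field; rewrite e0 gt_eqF.
Qed.

End Reduction.

(* The constant K depends on c only; the first bound does not involve c or K. *)
Theorem theorem4p5 (R : realType) (c : R) (c_gt0 : 0 < c) :
  exists K : R, 0 < K /\
  forall (N dw dth n : nat) (N_gt0 : (0 < N)%N) (n_gt0 : (0 < n)%N)
    (dX : measure_display) (X : measurableType dX)
    (Pi : 'I_N -> probability X R)
    (f : 'I_N -> 'rV[R]_dw -> 'rV[R]_dth -> X -> R)
    (f_int : forall i w th, (Pi i).-integrable [set: X] (EFin \o f i w th))
    (dOm : measure_display) (Om : measurableType dOm) (P : probability Om R)
    (xi : 'I_N -> nat -> {RV P >-> X})
    (zeta : nat -> {RV P >-> dw.-tuple R})
    (alpha sigma_zeta L G : R)
    (alpha_ge0 : 0 <= alpha) (sigma_zeta_ge0 : 0 <= sigma_zeta) (L_gt0 : 0 < L)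
    (xi_law : forall i (t : 'I_n), has_law (xi i t.+1) (Pi i))
    (zeta_law : forall t : 'I_n, isotropic_gaussian sigma_zeta (zeta t.+1))
    (indep : mutually_independent P (source_sigma (n := n) xi zeta))
    (zs : params R dw N dth)
    (A1_min : is_minimizer Pi f zs)
    (A1_fin : (norm_alpha alpha zs < +oo)%E)
    (A2 : forall i, {ae Pi i, forall x,
       jointly_convex (fun w th => f i w th x) /\
       smooth L (fun w th => f i w th x)})
    (A3 : forall i w th, {ae Pi i, forall x,
       l2norm (sample_grad_w f i w th x) <= G})
    (var_w_fin : forall i, (var_w Pi f zs i < +oo)%E)
    (var_th_fin : forall i, (var_th Pi f zs i < +oo)%E),
  let La := L_alpha (N := N) L alpha in
  let nz := fine (norm_alpha alpha zs) in
  let st := sigma_tot Pi f alpha sigma_zeta zs in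
  let eta := step_size Pi f n L alpha sigma_zeta zs in
  let zbar := fun om : Om =>
    ppsgd_avg f eta alpha G (fun i t => xi i t om)
      (fun t => row_of_tuple (zeta t om)) n in
  ('E_P[(fun om => risk Pi f (zbar om) - risk Pi f zs)%R]
     <= (4%:R * La * nz ^+ 2 / n%:R + 3%:R * (st * nz / Num.sqrt n%:R))%:E)%E
  /\
  (forall (eps delta : R), 0 < eps -> 0 < delta -> delta < 1 ->
     sigma_zeta = c * (G * Num.sqrt (n%:R * ln (1 / delta)) / (N%:R * eps)) ->
   ('E_P[(fun om => risk Pi f (zbar om) - risk Pi f zs)%R]
     <= (K * (La * nz ^+ 2 / n%:R
         + nz * Num.sqrt ((alpha * avg_var_w Pi f zs + avg_var_th Pi f zs)
                          / (N%:R * n%:R))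
         + nz * Num.sqrt (alpha * dw%:R * G ^+ 2 * ln (1 / delta)
                          / (N%:R ^+ 2 * eps ^+ 2))))%:E)%E).
Proof.
(* The three terms require the factors 4, 3 and 3c; their sum dominates each. *)
exists (7%:R + 3%:R * c); split; first by rewrite addr_gt0 ?mulr_gt0.
move=> N dw dth n N_gt0 n_gt0 dX X Pi f f_int dOm Om P xi zeta alpha sigma_zeta L G
  alpha_ge0 sigma_zeta_ge0 L_gt0 xi_law zeta_law indep zs A1_min A1_fin A2 A3
  var_w_fin var_th_fin La nz st eta zbar.
have N0 : 0 < (N%:R : R) by rewrite ltr0n.
have n0 : 0 < (n%:R : R) by rewrite ltr0n.
(* If [G] were negative, the gradient bound would fail at every sample, and the whole space would be
   a null set. *)
have G_ge0 : 0 <= G.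
  have [B [mB B0 HB]] := A3 (Ordinal N_gt0) 0 0.
  rewrite leNgt; apply/negP => G0.
  have BT : B = setT.
    apply/seteqP; split => // x _; apply: HB => /= Hx.
    by have := le_lt_trans Hx G0; rewrite ltNge l2norm_ge0.
  have : Pi (Ordinal N_gt0) setT = 1%E by exact: probability_setT.
  by rewrite -BT B0 => /eqP; rewrite eq_sym onee_eq0.
have /choice[bad Hbad] : forall i, exists B, [/\ measurable B, Pi i B = 0%E &
    forall x, ~ B x -> good_sample f L G i x].
  move=> i; have [B [mB B0 HB]] := ae_good_sample L_gt0 G_ge0 (A2 i) (A3 i).
  by exists B; split => // x /(contra_notP (@HB x)).
(* For [alpha = 0], finiteness of the norm is what forces [zs.1 = 0], the case in which [nsq] gives
   the right value. *)
have [zs1_alpha0 nzE] : (alpha = 0 -> zs.1 = 0) /\ nz = Num.sqrt (nsq alpha zs).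
  move: A1_fin; rewrite /nz /norm_alpha /normsq_alpha /nsq.
  rewrite -l2norm_dot -l2norm_sqr.
  case: eqVneq => [->|a0]; last by move=> _; split => // a1; rewrite a1 eqxx in a0.
  by case: eqVneq => // z10 _; split => //; rewrite invr0 mul0r add0r.
have nsq0 : 0 <= nsq alpha zs by exact: nsq_ge0.
have nz0 : 0 <= nz by rewrite nzE sqrtr_ge0.
have nz2 : nz ^+ 2 = nsq alpha zs by rewrite nzE sqr_sqrtr.
have st0 : 0 <= st by exact: sqrtr_ge0.
pose rn : R := Num.sqrt n%:R.
have rn0 : 0 < rn by rewrite sqrtr_gt0.
have rn2 : rn ^+ 2 = n%:R by rewrite sqr_sqrtr// ltW.
have La0 : 0 < La.
  by rewrite mulr_gt0// lt_max invr_gt0 N0 orbT.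
have La4 : 0 < 4%:R * La by exact: mulr_gt0.
have eta1_gt0 : 0 < 1 / (4%:R * La) by exact: divr_gt0.
have etaE : eta = if st == 0 then 1 / (4%:R * La)
    else Num.min (1 / (4%:R * La)) (nz / (rn * st)).
  exact: erefl.
have eta_le1 : eta <= 1 / (4%:R * La).
  by rewrite etaE; case: ifP => // _; rewrite ge_min lexx.
have eta_le2 : st != 0 -> eta <= nz / (rn * st).
  by move=> s0; rewrite etaE (negbTE s0) ge_min lexx orbT.
have eta_ge0 : 0 <= eta.
  rewrite etaE; case: ifP => _; first exact: ltW.
  by rewrite le_min (ltW eta1_gt0)/= divr_ge0// mulr_ge0// ltW.
have eta_cases : eta = 1 / (4%:R * La) \/ st != 0 /\ eta = nz / (rn * st).
  rewrite etaE; case: eqVneq => s0; first by left.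
  by rewrite minElt; case: ifP => _; [left|right].
have etaL : 4%:R * L * Num.max alpha N%:R^-1 * eta <= 1.
  have -> : 4%:R * L * Num.max alpha N%:R^-1 = 4%:R * La by rewrite mulrA.
  by rewrite mulrC -ler_pdivlMr//.
have eta0 : eta = 0 -> nsq alpha zs = 0.
  move=> e0; case: eta_cases => [e1|[s0 e2]].
    by move: eta1_gt0; rewrite -e1 e0 ltxx.
  have c0 : rn * st != 0 by rewrite mulf_neq0// gt_eqF.
  have : nz = 0 by rewrite -(divfK c0 nz) -e2 e0 mul0r.
  by rewrite -nz2 => ->; rewrite expr0n.
have first_bound : ('E_P[(fun om => risk Pi f (zbar om) - risk Pi f zs)%R]
    <= (4%:R * La * nz ^+ 2 / n%:R + 3%:R * (st * nz / Num.sqrt n%:R))%:E)%E.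
  have bm i : measurable (bad i) by have [] := Hbad i.
  have b0 i : Pi i (bad i) = 0%E by have [] := Hbad i.
  have bP i x : ~ bad i x -> good_sample f L G i x by have [_ _] := Hbad i; exact.
  apply: le_trans (expected_gap_le N_gt0 n_gt0 f_int alpha_ge0 L_gt0 G_ge0
    xi_law zeta_law indep A1_min zs1_alpha0 var_th_fin bm b0 bP eta_ge0 etaL eta0) _.
  rewrite lee_fin -nz2 -/st -/rn -rn2.
  have [e0|e0] := eqVneq eta 0.
    rewrite e0 mulr0 !mul0r invr0 mulr0 addr0.
    have h1 : 0 <= 4%:R * La * nz ^+ 2 / rn ^+ 2.
      exact: divr_ge0 (mulr_ge0 (ltW La4) (sqr_ge0 _)) (sqr_ge0 _).
    have h2 : 0 <= 3%:R * (st * nz / rn).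
      by rewrite mulr_ge0// divr_ge0 ?mulr_ge0// ltW.
    exact: addr_ge0.
  by apply: step_size_bound => //; rewrite lt_neqAle eq_sym e0.
split=> // eps delta eps0 delta0 delta1 szE.
apply: (le_trans first_bound); rewrite lee_fin -/rn.
set a := alpha * avg_var_w Pi f zs + avg_var_th Pi f zs.
have a0 : 0 <= a.
  rewrite addr_ge0 ?mulr_ge0 ?invr_ge0 ?(ltW N0)//; apply: sumr_ge0 => i _;
    apply: fine_ge0; apply: expectation_ge0 => x; exact: sqr_ge0.
have ln0 : 0 <= ln (1 / delta).
  by rewrite ln_ge0// ler_pdivlMr// mul1r ltW.
set T := alpha * dw%:R * G ^+ 2 * ln (1 / delta) / (N%:R ^+ 2 * eps ^+ 2).
have T0 : 0 <= T.
  by rewrite divr_ge0 ?mulr_ge0 ?(ltW eps0).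
(* The factor n in sigma_zeta^2 cancels the division by n, which is why the privacy term does not
   decay with the number of rounds. *)
have stE : st / rn <= Num.sqrt (a / (N%:R * n%:R)) + c * Num.sqrt T.
  have -> : c * Num.sqrt T = Num.sqrt (c ^+ 2 * T).
    by rewrite [RHS]sqrtrM ?sqr_ge0// sqrtr_sqr gtr0_norm.
  have -> : st / rn = Num.sqrt (a / (N%:R * n%:R) + c ^+ 2 * T).
    rewrite /st /sigma_tot -/a /rn -sqrtrV ?(ltW n0)// -sqrtrM; last first.
      rewrite addr_ge0 ?divr_ge0 ?(ltW N0)//.
      by rewrite mulr_ge0 ?sqr_ge0// mulr_ge0.
    congr Num.sqrt; rewrite szE /T !exprMn sqr_sqrtr ?mulr_ge0 ?(ltW n0)//.
    by rewrite exprVn exprMn; field; rewrite !gt_eqF.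
  apply: sqrtrD_le; first exact: divr_ge0 a0 (mulr_ge0 (ltW N0) (ltW n0)).
  exact: mulr_ge0 (sqr_ge0 c) T0.
have H1 := ler_wpM2l nz0 stE.
have q0 : 0 <= La * nz ^+ 2 / n%:R.
  exact: divr_ge0 (mulr_ge0 (ltW La0) (sqr_ge0 _)) (ltW n0).
have q1 : 0 <= nz * Num.sqrt (a / (N%:R * n%:R)).
  exact: mulr_ge0 nz0 (sqrtr_ge0 _).
have q2 : 0 <= nz * Num.sqrt T by exact: mulr_ge0 nz0 (sqrtr_ge0 _).
have e1 : 4%:R * La * nz ^+ 2 / n%:R = 4%:R * (La * nz ^+ 2 / n%:R) by rewrite !mulrA.
have e2 : st * nz / rn = nz * (st / rn) by rewrite mulrA (mulrC nz).
rewrite e1 e2; move: H1 q0 q1 q2.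
set A := La * nz ^+ 2 / n%:R; set B := Num.sqrt (a / _); set D := Num.sqrt T.
set V := st / rn.
rewrite mulrDr (mulrCA nz c) => H1 q0 q1 q2.
have r0 := mulr_ge0 (ltW c_gt0) q0; have r1 := mulr_ge0 (ltW c_gt0) q1.
have r2 := mulr_ge0 (ltW c_gt0) q2.
move: H1 q0 q1 q2 r0 r1 r2; move: (nz * B) (nz * D) (nz * V) A => x y z w.
by move=> *; rewrite mulrDl; nra.
Qed.
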